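(* Let $P\in\mathbb{C}[x,y]$ have no zeros in $\mathbb{H}^2$, satisfy $P(0,0)=0$, and have no common factors with $\bar P$, and let $L_1,\dots,L_M$, $q_1,\dots,q_M$ be the data of $[P]$ described in the context. Let $K=\max\{2L_1,\dots,2L_M\}$. Then $$\mathcal{I}^{K+1}_P\subset\prod_{j=1}^M\bigl(y+q_j(x),\,x^{2L_j}\bigr),$$ and consequently $$\prod_{j=1}^M\bigl(y+q_j(x),x^{2L_j}\bigr)=\mathcal{I}^{K+1}_P=\mathcal{I}^{\infty}_P,$$ where the left side is the product of the ideals $(y+q_j(x),x^{2L_j})$ in $\mathbb{C}\{x,y\}$.
   Context: $\mathbb{H}=\{z\in\mathbb{C}:\operatorname{Im} z>0\}$. $\bar P(x,y)=\overline{P(\bar x,\bar y)}$. $\mathbb{C}\{x,y\}$ is the ring of convergent power series at $(0,0)$. $f\in L^{\mathfrak{p}}_{loc}$ means $f\in L^{\mathfrak{p}}(U)$ for some neighborhood $U$ of $(0,0)$ in $\mathbb{R}^2$; $\mathcal{I}^{\mathfrak{p}}_P=\{Q\in\mathbb{C}\{x,y\}:Q/P\in L^{\mathfrak{p}}_{loc}\}$. By a theorem of Bickel–Knese–Pascoe–Sola, for such $P$ vanishing to order $M$ at $(0,0)$ there exist $L_1,\dots,L_M\in\mathbb{N}$ and $q_1,\dots,q_M\in\mathbb{R}[x]$ with $q_j(0)=0$, $q_j'(0)>0$, $\deg q_j<2L_j$, such that $[P]=\prod_{j=1}^M(y+q_j(x)+ix^{2L_j})$ satisfies: $P/[P]$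 and $[P]/P$ are bounded on a punctured neighborhood of $(0,0)$ in $\mathbb{R}^2$. *)

(* Defs.v *)
From HB Require Import structures.
From mathcomp Require Import all_boot all_order all_algebra.
From mathcomp Require Import all_classical all_reals all_analysis.
From mathcomp Require Import complex.

Set Implicit Arguments.
Unset Strict Implicit.
Unset Printing Implicit Defensive.

Import Order.TTheory GRing.Theory Num.Theory.
Import numFieldNormedType.Exports.
Local Open Scope ring_scope.
Local Open Scope classical_set_scope.
Local Open Scope complex_scope.

Section Defs.
Variable R : realType.
Local Notation C := R[i].

Definition cabs (z : C) : R := Normc.normc z.

(* ---------- Polynomials in C[x,y] ----------
   P : {poly {poly C}}: outer variable is y, inner variable is x,
   i.e. P = \sum_j P`_j(x) y^j. *)
Definition peval (P : {poly {poly C}}) (x y : C) : C := (P.[y%:P]).[x].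

Definition pcoef (P : {poly {poly C}}) (i j : nat) : C := (P`_j)`_i.

(* \bar P(x,y) = conj (P (conj x, conj y)) : conjugate all coefficients *)
Definition pconj (P : {poly {poly C}}) : {poly {poly C}} :=
  map_poly (map_poly (@conjc R)) P.

Definition vanishing_order (P : {poly {poly C}}) (M : nat) : Prop :=
  (forall i j, (i + j < M)%N -> pcoef P i j = 0) /\
  exists i j, (i + j)%N = M /\ pcoef P i j != 0.

Definition no_common_factor (P Q : {poly {poly C}}) : Prop :=
  forall D E F : {poly {poly C}}, P = D * E -> Q = D * F -> D \is a GRing.unit.

(* ---------- Convergent power series C{x,y} ----------
   a power series is its coefficient array a i j (coefficient of x^i y^j). *)
Definition ps := nat -> nat -> C.

Definition convergent (a : ps) : Prop :=
  exists r : R, 0 < r /\ exists B : R, forall n : nat,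
    \sum_(i < n) \sum_(j < n) cabs (a i j) * r ^+ (i + j) <= B.

Definition ps_of_poly (P : {poly {poly C}}) : ps := fun i j => pcoef P i j.
Definition ps_add (a b : ps) : ps := fun i j => a i j + b i j.
Definition ps_mul (a b : ps) : ps := fun i j =>
  \sum_(k < i.+1) \sum_(l < j.+1) a k l * b (i - k)%N (j - l)%N.
Definition ps_eq (a b : ps) : Prop := forall i j, a i j = b i j.

Definition ps_partial (a : ps) (x y : R) (n : nat) : C :=
  \sum_(i < n) \sum_(j < n) a i j * (x%:C) ^+ i * (y%:C) ^+ j.
Definition ps_eval (a : ps) (x y : R) : C :=
  let re : nat -> R := fun n => complex.Re (ps_partial a x y n) in
  let im : nat -> R := fun n => complex.Im (ps_partial a x y n) in
  Complex (limn re) (limn im).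

Definition ideal2 (g h : ps) : ps -> Prop := fun f =>
  exists c d, convergent c /\ convergent d /\
    ps_eq f (ps_add (ps_mul c g) (ps_mul d h)).

Definition ideal_mul (I J : ps -> Prop) : ps -> Prop := fun f =>
  exists (n : nat) (a b : nat -> ps),
    (forall k, (k < n)%N -> I (a k) /\ J (b k)) /\
    ps_eq f (fun i j => \sum_(k < n) ps_mul (a k) (b k) i j).

(* product of a finite list of ideals; the empty product is the unit ideal *)
Definition ideal_prod (Is : seq (ps -> Prop)) : ps -> Prop :=
  foldr ideal_mul convergent Is.

Definition sqr (e : R) : set (R * R) := [set z | `|z.1| < e /\ `|z.2| < e].

Definition leb2 := ((@lebesgue_measure R) \x (@lebesgue_measure R))%E.

Definition cmeasurable (D : set (R * R)) (f : R * R -> C) : Prop :=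
  measurable_fun D (fun z => complex.Re (f z)) /\
  measurable_fun D (fun z => complex.Im (f z)).

Definition Lp_loc (p : nat) (f : R * R -> C) : Prop :=
  exists e : R, 0 < e /\ cmeasurable (sqr e) f /\
    (\int[leb2]_(z in sqr e) ((cabs (f z)) ^+ p)%:E < +oo)%E.

Definition Linf_loc (f : R * R -> C) : Prop :=
  exists e : R, 0 < e /\ cmeasurable (sqr e) f /\
    exists B : R, {ae leb2, forall z, sqr e z -> cabs (f z) <= B}.

Definition Ip (P : {poly {poly C}}) (p : nat) : ps -> Prop := fun Q =>
  convergent Q /\
  Lp_loc p (fun z => ps_eval Q z.1 z.2 / peval P (z.1)%:C (z.2)%:C).
Definition Iinf (P : {poly {poly C}}) : ps -> Prop := fun Q =>
  convergent Q /\
  Linf_loc (fun z => ps_eval Q z.1 z.2 / peval P (z.1)%:C (z.2)%:C).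

Definition bracketP (M : nat) (L : nat -> nat) (q : nat -> {poly R})
    (x y : R) : C :=
  \prod_(j < M) (y%:C + ((q j).[x])%:C + 'i * (x%:C) ^+ (2 * L j)).

(* L_1..L_M, q_1..q_M are data of [P] as in Bickel-Knese-Pascoe-Sola *)
Definition bracket_data (P : {poly {poly C}}) (M : nat) (L : nat -> nat)
    (q : nat -> {poly R}) : Prop :=
  vanishing_order P M /\
  (forall j, (j < M)%N ->
     (q j).[0] = 0 /\ 0 < ((q j)^`()).[0] /\ (size (q j) <= 2 * L j)%N) /\
  (exists e B : R, 0 < e /\ forall x y : R, (x, y) != (0, 0) ->
     `|x| < e -> `|y| < e ->
     [/\ peval P x%:C y%:C != 0,
         cabs (peval P x%:C y%:C / bracketP M L q x y) <= B &
         cabs (bracketP M L q x y / peval P x%:C y%:C) <= B]).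

Definition gen_y (q : {poly R}) : ps :=
  ps_of_poly ('X + (map_poly (real_complex R) q)%:P).
Definition gen_x (L : nat) : ps := ps_of_poly (('X^(2 * L))%:P).

Definition Jprod (M : nat) (L : nat -> nat) (q : nat -> {poly R}) : ps -> Prop :=
  ideal_prod [seq ideal2 (gen_y (q j)) (gen_x (L j)) | j <- iota 0 M].

End Defs.

(* Main.v *)
(* Write a_j = 2 L_j and w_j = y + q_j(x).  On the curves y = t x^a_j - q_j(x) with
   t bounded, [P] has size at most x^n_j, where n_j is the sum over i of
   min(ord(q_i - q_j), a_i, a_j).  If Q restricted to these curves were not
   divisible by x^n_j in C[x,t], then |Q/P| >= c/x on {0 < x < d, t1 < t < t2}, a
   region whose slice at x has length (t2 - t1) x^a_j; since a_j <= K this makes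
   the integral of |Q/P|^(K+1) infinite.

   These divisibility conditions characterise the product of the ideals
   (w_j, x^a_j).  Take m with a_m maximal and let J' be the product of the
   other ideals.  Choosing w_i or x^a_i in each of them gives an element B of J'
   whose restriction to w_m = 0 is exactly x^(n_m - a_m) times a unit; subtracting
   a multiple of x^a_m B from Q makes it vanish on w_m = 0, hence divisible by
   w_m, and the quotient satisfies the conditions for J' because x is prime in
   C[x,t].

   All of this takes place in C[x,y]: x^N and y^N lie in the product ideal for
   N = sum a_j, so membership of a convergent series depends only on its
   truncation, and the product ideal is bounded by [P] because w_j and x^a_j are
   real, hence both at most |w_j + i x^a_j|. *)
Require Import Defs.
From HB Require Import structures.
From mathcomp Require Import all_boot all_order all_algebra.
From mathcomp Require Import all_classical all_reals all_analysis.
From mathcomp Require Import measurable_realfun.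
From mathcomp Require Import complex ring.

Set Implicit Arguments.
Unset Strict Implicit.
Unset Printing Implicit Defensive.

Import Order.TTheory GRing.Theory Num.Theory.
Import numFieldNormedType.Exports.
Local Open Scope ring_scope.

(** * Products of the ideals (y + q, x^a) in F[x,y] *)

Section ContactIdeal.
Variable F : fieldType.
Implicit Types (p A B U V : {poly {poly F}}) (s : seq ({poly F} * nat))
  (u v m j : {poly F} * nat).

(* The pair [u = (q, a)] stands for the ideal [(y + q, x^a)]; in
   [{poly {poly F}}] the outer variable is [y] and the inner one is [x]. *)
Definition ybr u : {poly {poly F}} := 'X + u.1%:P.
Definition xbr u : {poly {poly F}} := ('X^(u.2))%:P.

(** Membership in the product of the ideals of [s]. A product [(g, h) J] equals [g J + h J], so two
    cofactors per ideal suffice and no sums of products occur; the empty product is the whole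
    ring. *)
Fixpoint Jpoly s p : Prop :=
  if s is u :: s' then
    exists A B, [/\ Jpoly s' A, Jpoly s' B & p = ybr u * A + xbr u * B]
  else True.

Lemma Jpoly0 s : Jpoly s 0.
Proof. by elim: s => //= u s IH; exists 0, 0; rewrite !mulr0 addr0. Qed.

Lemma JpolyD s p1 p2 : Jpoly s p1 -> Jpoly s p2 -> Jpoly s (p1 + p2).
Proof.
elim: s p1 p2 => //= u s IH p1 p2 [A1 [B1 [? ? ->]]] [A2 [B2 [? ? ->]]].
exists (A1 + A2), (B1 + B2); split; [exact: IH|exact: IH|ring].
Qed.

Lemma JpolyM s p1 p2 : Jpoly s p1 -> Jpoly s (p2 * p1).
Proof.
elim: s p1 => //= u s IH p1 [A1 [B1 [? ? ->]]].
exists (p2 * A1), (p2 * B1); split; [exact: IH|exact: IH|ring].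
Qed.

Lemma Jpoly_sum s n (G : 'I_n -> {poly {poly F}}) :
  (forall i, Jpoly s (G i)) -> Jpoly s (\sum_i G i).
Proof.
move=> h; apply: (big_ind (Jpoly s)) => // [|x y]; [exact: Jpoly0|exact: JpolyD].
Qed.

Lemma Jpoly_ybr u s p : Jpoly s p -> Jpoly (u :: s) (ybr u * p).
Proof.
move=> h; exists p, 0; split=> //; [exact: Jpoly0|by rewrite mulr0 addr0].
Qed.

Lemma Jpoly_xbr u s p : Jpoly s p -> Jpoly (u :: s) (xbr u * p).
Proof.
move=> h; exists 0, p; split=> //; [exact: Jpoly0|by rewrite mulr0 add0r].
Qed.

(** Multiplication of ideals is commutative: exchanging the two outermost combinations moves [m]
    past one pair at a time. *)
Lemma Jpoly_rem m s p : m \in s -> Jpoly (m :: rem m s) p -> Jpoly s p.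
Proof.
elim: s p => // u s IH p; rewrite inE /=.
have [->|neq /=] := eqVneq u m; first by [].
move=> ms [A [B [[A1 [A2 [hA1 hA2 ->]]]
  [B1 [B2 [hB1 hB2 ->]]] ->]]].
exists (ybr m * A1 + xbr m * B1), (ybr m * A2 + xbr m * B2); split; last by ring.
- by apply: (IH) => //; exists A1, B1.
- by apply: (IH) => //; exists A2, B2.
Qed.

Lemma Jpoly_xN s : Jpoly s ('X^(\sum_(u <- s) u.2))%:P.
Proof.
elim: s => //= u s IH; rewrite big_cons exprD polyCM.
exact: Jpoly_xbr.
Qed.

(** In each ideal [y^a = (y^a - (-q)^a) + (-q)^a]; the first term is divisible by [y + q], the
    second by [x^a] because [q(0) = 0]. *)
Lemma Jpoly_yN s : (forall u, u \in s -> u.1.[0] = 0) ->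
  Jpoly s 'X^(\sum_(u <- s) u.2).
Proof.
elim: s => [//|u s IH] h; rewrite big_cons exprD.
have {}IH : Jpoly s 'X^(\sum_(j <- s) j.2).
  by apply: IH => v vs; apply: h; rewrite inE vs orbT.
have /factor_theorem [g hg] : root u.1 0 by apply/rootP/h; rewrite inE eqxx.
have /factor_theorem [k hk] : root ('X^(u.2) - ((- u.1) ^+ u.2)%:P : {poly {poly F}}) (- u.1).
  by rewrite rootE !hornerE subrr.
have -> : 'X^(u.2) = ybr u * k + xbr u * ((- g) ^+ u.2)%:P.
  rewrite -[LHS](subrK ((- u.1) ^+ u.2)%:P) hk /ybr /xbr polyCN opprK mulrC.
  by congr (_ + _); rewrite -polyCM -exprMn hg polyC0 subr0; congr (_ ^+ _)%:P; ring.
rewrite mulrDl -!mulrA; apply: JpolyD.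
- by apply: Jpoly_ybr; apply: JpolyM.
- by apply: Jpoly_xbr; apply: JpolyM.
Qed.

(** * Divisibility by powers of [x] in [F[x,t]] *)

Definition xdiv n U := exists U', U = ('X^n)%:P * U'.

Lemma xdiv_le n k U : (k <= n)%N -> xdiv n U -> xdiv k U.
Proof.
move=> kn [V ->]; exists (('X^(n - k))%:P * V).
by rewrite mulrA -polyCM -exprD subnKC.
Qed.

Lemma xdivD n U V : xdiv n U -> xdiv n V -> xdiv n (U + V).
Proof. by move=> [U' ->] [V' ->]; exists (U' + V'); rewrite mulrDr. Qed.

Lemma xdivN n U : xdiv n U -> xdiv n (- U).
Proof. by move=> [U' ->]; exists (- U'); rewrite mulrN. Qed.

Lemma xdivM n k U V : xdiv n U -> xdiv k V -> xdiv (n + k) (U * V).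
Proof.
by move=> [U' ->] [V' ->]; exists (U' * V'); rewrite exprD polyCM; ring.
Qed.

(* Reduction modulo [x] of a polynomial in [x] (inner) and [t] (outer). *)
Definition at0 U : {poly F} := map_poly (horner_eval 0) U.

Lemma at0_xdiv U : at0 U = 0 -> xdiv 1 U.
Proof.
move=> h; exists (\poly_(i < size U) (U`_i %/ 'X)).
apply/polyP=> i; rewrite coefCM coef_poly expr1.
case: ltnP => hi; last by rewrite mulr0 nth_default.
have : root U`_i 0.
  have := congr1 (fun z : {poly F} => z`_i) h.
  by rewrite coef_map coef0 /= => /eqP.
by rewrite -dvdp_XsubCl polyC0 subr0 => hd; rewrite mulrC divpK.
Qed.

Lemma at0_X U : at0 ('X%:P * U) = 0.
Proof. by rewrite /at0 rmorphM /= map_polyC /= /horner_eval hornerX mul0r. Qed.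

(** The element [x] is prime: [at0] is a ring morphism into a domain, so a factor [U] that survives
    it absorbs no power of [x]. *)
Lemma xdiv_cancel n U V : at0 U != 0 -> xdiv n (U * V) -> xdiv n V.
Proof.
move=> hU; elim: n V => [|n IH] V h; first by exists V; rewrite mul1r.
have [V' hV'] : xdiv 1 V.
  apply: at0_xdiv; case: h => W hW; have := congr1 at0 hW.
  rewrite exprS polyCM -mulrA at0_X /at0 rmorphM /= => /eqP.
  by rewrite mulf_eq0 (negPf hU) /= => /eqP.
have : xdiv n V'.
  apply: IH; case: h => W hW; exists W.
  apply: (@mulfI _ ('X%:P)); first by rewrite polyC_eq0 polyX_eq0.
  by rewrite [RHS]mulrA -polyCM -exprS -hW hV' expr1; ring.
by case=> W hW; exists W; rewrite hV' hW mulrA -polyCM -exprD add1n.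
Qed.

(** * Pullback to the curves [y = t x^a - q(x)] and orders of contact *)

Definition curve j : {poly {poly F}} := ('X^(j.2))%:P * 'X - j.1%:P.
Definition pull j p := p \Po curve j.

(* [minn (minn u.2 v.2) (ord (u.1 - v.1))], where [ord 0] is infinite *)
Definition contact u v : nat :=
  find (fun k => (u.1 - v.1)`_k != 0) (iota 0 (minn u.2 v.2)).

Lemma contact_le u v : (contact u v <= minn u.2 v.2)%N.
Proof. by rewrite -[leqRHS](size_iota 0); apply: find_size. Qed.

Lemma contact_lel u v : (contact u v <= u.2)%N.
Proof. exact: leq_trans (contact_le u v) (geq_minl _ _). Qed.

Lemma contact_ler u v : (contact u v <= v.2)%N.
Proof. exact: leq_trans (contact_le u v) (geq_minr _ _). Qed.

Lemma contact_id u : contact u u = u.2.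
Proof.
rewrite /contact minnn subrr hasNfind ?size_iota //.
by apply/hasPn => k _; rewrite coef0 eqxx.
Qed.

(** All coefficients of the difference below the contact vanish. If the contact is smaller than both
    exponents, it is the exact order of the difference, hence the nonzero constant term of the
    cofactor. *)
Lemma contact_factor u v : exists g : {poly F}, u.1 - v.1 = 'X^(contact u v) * g /\
  ((contact u v < minn u.2 v.2)%N -> g.[0] != 0).
Proof.
set d := u.1 - v.1; exists (drop_poly (contact u v) d); split.
  rewrite -{1}(poly_take_drop (contact u v) d) mulrC.
  suff -> : take_poly (contact u v) d = 0 by rewrite add0r.
  apply/polyP => k; rewrite coef_take_poly coef0; case: ifP => // hk.
  have hk' := leq_trans hk (contact_le u v).
  have := before_find 0 hk; rewrite nth_iota // add0n => /negbT.
  by rewrite negbK => /eqP.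
move=> h; rewrite horner_coef0 coef_drop_poly add0n.
have := h; rewrite -[X in (_ < X)%N](size_iota 0) -has_find => /(nth_find 0).
by rewrite nth_iota ?add0n.
Qed.

(** On the curve, [y + q_u] becomes [x^a_j t + (q_u - q_j)], and the contact divides both terms.
    When [a_j <= a_u], the cofactor is nonzero modulo [x]: if the contact is below [a_j], its
    constant term in [t] survives; otherwise the coefficient of [t] is 1. *)
Lemma pull_ybr u j :
  exists2 U, pull j (ybr u) = ('X^(contact u j))%:P * U
    & (j.2 <= u.2)%N -> at0 U != 0.
Proof.
have [g [hg g0]] := contact_factor u j.
exists (g%:P + ('X^(j.2 - contact u j))%:P * 'X).
  rewrite /pull /ybr comp_polyD comp_polyX comp_polyC /curve.
  rewrite mulrDr mulrA -!polyCM -hg -exprD subnKC ?contact_ler //.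
  by rewrite polyCB; ring.
move=> le_ju; apply/eqP => h.
have [lt|ge] := ltnP (contact u j) j.2.
  have := congr1 (fun z : {poly F} => z`_0) h.
  rewrite coef0 coef_map coefD coefC /= coefMX /= addr0 /horner_eval => /eqP.
  by rewrite (negPf (g0 _)) // leq_min lt (leq_trans lt).
have := congr1 (fun z : {poly F} => z`_1) h.
rewrite coef0 coef_map coefD coefC /= coefMX /= add0r coefC /= /horner_eval.
have -> : (j.2 - contact u j = 0)%N by apply/eqP; rewrite subn_eq0.
by rewrite expr0 hornerC => /eqP; rewrite oner_eq0.
Qed.

Lemma pull_xbr u j : pull j (xbr u) = xbr u.
Proof. by rewrite /pull /xbr comp_polyC. Qed.

Definition contact_sum s j := (\sum_(u <- s) contact u j)%N.

(** Necessity of the divisibility conditions: either generator of the ideal of [u] pulls back to a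
    multiple of [x^(contact u j)]. *)
Lemma Jpoly_pull s j p : Jpoly s p -> xdiv (contact_sum s j) (pull j p).
Proof.
elim: s p => [|u s IH] p /=.
  by move=> _; rewrite /contact_sum big_nil; exists (pull j p); rewrite mul1r.
move=> [A [B [/IH hA /IH hB ->]]]; rewrite /contact_sum big_cons.
rewrite /pull comp_polyD !comp_polyM; apply: xdivD.
  apply: xdivM => //.
  by have [U hU _] := pull_ybr u j; exists U.
apply: xdivM => //; rewrite -/(pull j _) pull_xbr.
by apply: (@xdiv_le u.2); [exact: contact_lel|exists 1; rewrite mulr1].
Qed.

(** In each ideal the generator realizing the contact with [m] is chosen: [y + q_u] when [q_u - q_m]
    has order below both exponents, and [x^a_u] otherwise, where [a_u <= a_m] makes the contact
    equal to [a_u]. *)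
Lemma Jpoly_sharp s m : (forall u, u \in s -> (u.2 <= m.2)%N) ->
  exists B (g : {poly F}), [/\ Jpoly s B, B.[- m.1] = 'X^(contact_sum s m) * g & g.[0] != 0].
Proof.
elim: s => [|u s IH] h.
  exists 1, 1; rewrite /contact_sum big_nil !hornerE.
  by split=> //; rewrite ?oner_eq0.
have [|B [g [hB hBg hg]]] := IH.
  by move=> v vs; apply: h; rewrite inE vs orbT.
rewrite /contact_sum big_cons -/(contact_sum s m).
have le_um : (u.2 <= m.2)%N by apply: h; rewrite inE eqxx.
have [lt|ge] := ltnP (contact u m) (minn u.2 m.2).
  have [k [hk k0]] := contact_factor u m.
  exists (ybr u * B), (k * g); split; first exact: Jpoly_ybr.
    have -> : (ybr u * B).[- m.1] = ('X^(contact u m) * k) * B.[- m.1].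
      by rewrite -hk hornerM /ybr hornerD hornerX hornerC addrC.
    by rewrite hBg exprD; ring.
  by rewrite hornerM mulf_neq0 // k0.
exists (xbr u * B), g; split=> //; first exact: Jpoly_xbr.
have -> : contact u m = u.2.
  by apply/eqP; rewrite eqn_leq contact_lel /= -(minn_idPl le_um).
by rewrite hornerM hBg /xbr hornerC exprD mulrA.
Qed.

Lemma pull_horner m p : (pull m p).[0] = p.[- m.1].
Proof. by rewrite /pull horner_comp /curve !hornerE. Qed.

(** Converse of [Jpoly_pull], by induction on the number of ideals. *)
Theorem Jpoly_of_pull s p :
  (forall j, j \in s -> xdiv (contact_sum s j) (pull j p)) -> Jpoly s p.
Proof.
move: {2}(size s) (erefl (size s)) => n; elim: n s p => [|n IH] s p hsz hp.
  by case: s hsz hp.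
(* Maximality of the exponent of [m] serves twice: for [Jpoly_sharp] on the other pairs, and for
   cancelling the pullback of [ybr m] along their curves. *)
have [m ms hmax] : exists2 m, m \in s & forall u, u \in s -> (u.2 <= m.2)%N.
  case: (s) hsz => [//|u0 s' _].
  elim: s' u0 => [|u1 s' IHs] u0.
    by exists u0; rewrite ?inE // => u; rewrite inE => /eqP ->.
  have [m ms hm] := IHs u1.
  have [le|lt] := leqP m.2 u0.2.
    exists u0; first by rewrite inE eqxx.
    by move=> u; rewrite inE => /orP[/eqP -> //|/hm /leq_trans]; apply.
  exists m; first by rewrite inE ms orbT.
  by move=> u; rewrite inE => /orP[/eqP ->|/hm //]; apply: ltnW.
apply: (Jpoly_rem ms); set s' := rem m s.
have sub : {subset s' <= s} by apply: mem_rem.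
have hsum j : contact_sum s j = (contact m j + contact_sum s' j)%N.
  by rewrite /contact_sum (perm_big _ (perm_to_rem ms)) big_cons.
have [u us'|B [g [hB hBg g0]]] := @Jpoly_sharp s' m; first exact/hmax/sub.
have [r hr] := hp m ms.
have {}hr : p.[- m.1] = 'X^(m.2 + contact_sum s' m) * r.[0].
  by rewrite -pull_horner hr hornerM hornerC hsum contact_id.
pose N := (\sum_(u <- s') u.2)%N.
(* The polynomial [g] is invertible only modulo powers of [x]. The Bezout remainder is a multiple of
   [x^N], and [x^N] lies in the product over [s']. *)
have [v [v' hv]] : exists v v' : {poly F}, r.[0] = g * v + 'X^N * v'.
  have : coprimep g ('X^N).
    apply: coprimep_expr; rewrite coprimepX.
    by rewrite rootE.
  move/Bezout_eq1_coprimepP => [[a b] /= hab].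
  exists (a * r.[0]), (b * r.[0]).
  by rewrite -[LHS]mul1r -hab; ring.
(* This element of the product ideal takes the same value as [p] on [y = -q_m]. *)
pose E := xbr m * (v%:P * B) + xbr m * (('X^(contact_sum s' m) * v')%:P * ('X^N)%:P).
have hE : Jpoly (m :: s') E.
  apply: JpolyD; apply: Jpoly_xbr; apply: JpolyM => //.
  exact: Jpoly_xN.
have /factor_theorem [Q hQ] : root (p - E) (- m.1).
  rewrite rootE hornerD hornerN hr /E /xbr !(hornerD, hornerM, hornerC) hBg hv.
  by rewrite exprD subr_eq0; apply/eqP; ring.
have {}hQ : p - E = ybr m * Q by rewrite hQ /ybr polyCN opprK mulrC.
rewrite -(subrK E p) hQ; apply: JpolyD => //; apply: Jpoly_ybr.
apply: IH => [|j js']; first by rewrite size_rem // hsz.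
have [U hU U0] := pull_ybr m j.
(* The pullback of [ybr m] is [x^(contact m j) U] with [U] nonzero modulo [x]; cancelling both
   factors leaves the condition on [Q] for [s']. *)
apply: (xdiv_cancel (U0 (hmax _ (sub _ js')))).
have : xdiv (contact m j + contact_sum s' j) (pull j (ybr m * Q)).
  rewrite -hQ -hsum /pull comp_polyB; apply: xdivD; first exact/hp/sub.
  by apply: xdivN; rewrite hsum; have := Jpoly_pull j hE; rewrite /contact_sum big_cons.
rewrite {1}/pull comp_polyM -!/(pull j _) hU => -[W hW]; exists W.
apply: (@mulfI _ (('X^(contact m j))%:P)).
  by rewrite polyC_eq0 expf_neq0 // polyX_eq0.
by rewrite mulrA hW exprD polyCM -mulrA.
Qed.

End ContactIdeal.

(** * Convergent power series and truncation *)

Section ComplexModulus.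
Variable R : realType.
Implicit Types z w : R[i].

Lemma cabsE z : cabs z = Num.sqrt (complex.Re z ^+ 2 + complex.Im z ^+ 2).
Proof. by case: z. Qed.

Lemma cabs_ge0 z : 0 <= cabs z.
Proof. by rewrite cabsE sqrtr_ge0. Qed.

Lemma cabs0 : cabs (0 : R[i]) = 0.
Proof. exact: Normc.normc0. Qed.

Lemma cabsM z w : cabs (z * w) = cabs z * cabs w.
Proof. exact: Normc.normcM. Qed.

Lemma cabsV z : cabs z^-1 = (cabs z)^-1.
Proof. exact: Normc.normcV. Qed.

Lemma cabsD z w : cabs (z + w) <= cabs z + cabs w.
Proof. exact: le_normcD. Qed.

Lemma cabsN z : cabs (- z) = cabs z.
Proof. exact: normcN. Qed.

Lemma cabsX z n : cabs (z ^+ n) = cabs z ^+ n.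
Proof.
elim: n => [|n IH]; first by rewrite !expr0 /cabs Normc.normc1.
by rewrite !exprS cabsM IH.
Qed.

Lemma cabs_eq0 z : cabs z = 0 -> z = 0.
Proof. exact: Normc.eq0_normc. Qed.

Lemma cabs_gt0 z : z != 0 -> 0 < cabs z.
Proof.
by move=> z0; rewrite lt_def cabs_ge0 andbT; apply: contra_neq z0 => /cabs_eq0.
Qed.

Lemma cabs_real (x : R) : cabs (x%:C)%C = `|x|.
Proof. by rewrite cabsE /= expr0n addr0 sqrtr_sqr. Qed.

Lemma cabs_Re z : `|complex.Re z| <= cabs z.
Proof.
by rewrite cabsE -sqrtr_sqr ler_wsqrtr // lerDl sqr_ge0.
Qed.

Lemma cabs_Im z : `|complex.Im z| <= cabs z.
Proof.
by rewrite cabsE -sqrtr_sqr ler_wsqrtr // lerDr sqr_ge0.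
Qed.

Lemma cabs_sum (I : Type) (r : seq I) (P : pred I) (G : I -> R[i]) :
  cabs (\sum_(i <- r | P i) G i) <= \sum_(i <- r | P i) cabs (G i).
Proof.
elim/big_rec2: _ => [|i y z _ h]; first by rewrite cabs0.
by apply: le_trans (cabsD _ _) _; rewrite lerD2l.
Qed.

End ComplexModulus.

Section PowerSeries.
Variable R : realType.
Local Notation C := R[i].
Implicit Types (f g h c d : ps R) (p : {poly {poly C}}).

(** Congruence modulo the ideal [(x^N, y^N)]. *)
Definition agree N f g := forall i j, (i < N)%N -> (j < N)%N -> f i j = g i j.

Definition trunc N f : {poly {poly C}} := \poly_(j < N) \poly_(i < N) f i j.

Lemma pcoef_trunc N f i j :
  pcoef (trunc N f) i j = if (i < N)%N && (j < N)%N then f i j else 0.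
Proof.
rewrite /pcoef /trunc coef_poly; case: (ltnP j N) => hj.
  by rewrite coef_poly andbT.
by rewrite andbF coef0.
Qed.

Lemma agree_trunc N f : agree N f (ps_of_poly (trunc N f)).
Proof. by move=> i j hi hj; rewrite /ps_of_poly pcoef_trunc hi hj. Qed.

Lemma ps_of_polyM p1 p2 :
  ps_of_poly (p1 * p2) = ps_mul (ps_of_poly p1) (ps_of_poly p2).
Proof.
apply/funext => i; apply/funext => j; rewrite /ps_of_poly /pcoef /ps_mul coefM.
rewrite coef_sum exchange_big /=; apply: eq_bigr => l _.
by rewrite coefM.
Qed.

Lemma ps_of_polyD p1 p2 :
  ps_of_poly (p1 + p2) = ps_add (ps_of_poly p1) (ps_of_poly p2).
Proof.
by apply/funext => i; apply/funext => j; rewrite /ps_of_poly /ps_add /pcoef !coefD.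
Qed.

Lemma agree_mul N f f' g g' : agree N f f' -> agree N g g' ->
  agree N (ps_mul f g) (ps_mul f' g').
Proof.
move=> hf hg i j hi hj; apply: eq_bigr => k _; apply: eq_bigr => l _.
have hk : (k < N)%N by apply: leq_trans hi; rewrite ltnS -ltnS.
have hl : (l < N)%N by apply: leq_trans hj; rewrite ltnS -ltnS.
rewrite hf // hg //.
- exact: leq_ltn_trans (leq_subr _ _) hi.
- exact: leq_ltn_trans (leq_subr _ _) hj.
Qed.

Lemma agree_add N f f' g g' : agree N f f' -> agree N g g' ->
  agree N (ps_add f g) (ps_add f' g').
Proof. by move=> hf hg i j hi hj; rewrite /ps_add hf ?hg. Qed.

Lemma agree_sym N f g : agree N f g -> agree N g f.
Proof. by move=> h i j hi hj; rewrite h. Qed.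

Lemma agree_trans N f g h : agree N f g -> agree N g h -> agree N f h.
Proof. by move=> h1 h2 i j hi hj; rewrite h1 ?h2. Qed.

Lemma agreeP f g : (forall N, agree N f g) -> f = g.
Proof.
move=> h; apply/funext => i; apply/funext => j.
by apply: (h (maxn i j).+1); rewrite ltnS ?leq_maxl ?leq_maxr.
Qed.

(** Each coefficient depends on finitely many others, so the ring laws for series follow from those
    for polynomials by truncation. *)
Lemma ps_mulA f g h : ps_mul f (ps_mul g h) = ps_mul (ps_mul f g) h.
Proof.
apply: agreeP => N; have hT := @agree_trunc N.
apply: agree_trans (agree_mul (hT f) (agree_mul (hT g) (hT h))) _.
apply: agree_sym; apply: agree_trans (agree_mul (agree_mul (hT f) (hT g)) (hT h)) _.
by rewrite -!ps_of_polyM mulrA.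
Qed.

Lemma ps_mulDr f g h : ps_mul f (ps_add g h) = ps_add (ps_mul f g) (ps_mul f h).
Proof.
apply: agreeP => N; have hT := @agree_trunc N.
apply: agree_trans (agree_mul (hT f) (agree_add (hT g) (hT h))) _.
apply: agree_sym.
apply: agree_trans (agree_add (agree_mul (hT f) (hT g)) (agree_mul (hT f) (hT h))) _.
by rewrite -!(ps_of_polyM, ps_of_polyD) mulrDr.
Qed.

Lemma ps_mulDl f g h : ps_mul (ps_add g h) f = ps_add (ps_mul g f) (ps_mul h f).
Proof.
apply: agreeP => N; have hT := @agree_trunc N.
apply: agree_trans (agree_mul (agree_add (hT g) (hT h)) (hT f)) _.
apply: agree_sym.
apply: agree_trans (agree_add (agree_mul (hT g) (hT f)) (agree_mul (hT h) (hT f))) _.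
by rewrite -!(ps_of_polyM, ps_of_polyD) mulrDl.
Qed.

Lemma ps_mul_xN N f i j :
  ps_mul (ps_of_poly ('X^N)%:P) f i j = if (i < N)%N then 0 else f (i - N)%N j.
Proof.
pose n := (maxn i j).+1.
have hi : (i < n)%N by rewrite ltnS leq_maxl.
have hj : (j < n)%N by rewrite ltnS leq_maxr.
rewrite (agree_mul (f' := ps_of_poly ('X^N)%:P) _ (@agree_trunc n f) hi hj) //.
rewrite -ps_of_polyM /ps_of_poly /pcoef coefCM coefXnM.
case: ifP => // _; rewrite -/(pcoef _ _ _) pcoef_trunc hj.
by rewrite (leq_ltn_trans (leq_subr _ _) hi).
Qed.

Lemma ps_mul_yN N f i j :
  ps_mul (ps_of_poly 'X^N) f i j = if (j < N)%N then 0 else f i (j - N)%N.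
Proof.
pose n := (maxn i j).+1.
have hi : (i < n)%N by rewrite ltnS leq_maxl.
have hj : (j < n)%N by rewrite ltnS leq_maxr.
rewrite (agree_mul (f' := ps_of_poly 'X^N) _ (@agree_trunc n f) hi hj) //.
rewrite -ps_of_polyM /ps_of_poly /pcoef coefXnM.
case: ifP => _; first by rewrite coef0.
by rewrite -/(pcoef _ _ _) pcoef_trunc hi (leq_ltn_trans (leq_subr _ _) hj).
Qed.

Lemma geometric_half_le n : \sum_(i < n) (2^-1 : R) ^+ i <= 2.
Proof.
suff -> : \sum_(i < n) (2^-1 : R) ^+ i = 2 - 2 * 2^-1 ^+ n.
  by rewrite gerBl mulr_ge0 // exprn_ge0 // invr_ge0.
elim: n => [|n IH]; first by rewrite big_ord0 expr0 mulr1 subrr.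
by rewrite big_ord_recr /= IH exprS; field.
Qed.

(** Convergence is handled from here on as a geometric bound on the coefficients. *)
Lemma convergentP f : convergent f <-> exists A B : R, [/\ 0 < A, 0 <= B &
  forall i j, cabs (f i j) <= B * A ^+ (i + j)].
Proof.
split=> [[r [r0 [B hB]]]|[A [B [A0 B0 h]]]].
  exists r^-1, B; split; first by rewrite invr_gt0.
    by have := hB 0%N; rewrite big_ord0.
  move=> i j; pose n := (maxn i j).+1.
  have hi : (i < n)%N by rewrite ltnS leq_maxl.
  have hj : (j < n)%N by rewrite ltnS leq_maxr.
  rewrite exprVn ler_pdivlMr ?exprn_gt0 //; apply: le_trans (hB n).
  have pos k l : 0 <= cabs (f k l) * r ^+ (k + l).
    by rewrite mulr_ge0 ?cabs_ge0 ?exprn_ge0 // ltW.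
  rewrite (bigD1 (Ordinal hi)) //= (bigD1 (Ordinal hj)) //= -addrA lerDl.
  by rewrite addr_ge0 ?sumr_ge0 // => k _; rewrite sumr_ge0.
(* At this radius the terms are at most [B 2^-(i+j)], and each of the two geometric sums is at most
   2. *)
exists (2 * A)^-1; split; first by rewrite invr_gt0 mulr_gt0.
exists (B * (2 * 2)) => n.
apply: (@le_trans _ _ (\sum_(i < n) \sum_(j < n) B * (2^-1 ^+ i * 2^-1 ^+ j))).
  apply: ler_sum => i _; apply: ler_sum => j _.
  apply: le_trans (ler_wpM2r _ (h i j)) _.
    by rewrite exprn_ge0 // invr_ge0 mulr_ge0 // ltW.
  rewrite -mulrA -exprMn -exprD invfM.
  by rewrite mulrCA divff ?mulr1 // gt_eqF.
rewrite (eq_bigr (fun i : 'I_n => B * (2^-1 ^+ i * \sum_(j < n) 2^-1 ^+ j))); last first.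
  by move=> i _; rewrite !mulr_sumr.
rewrite -mulr_sumr ler_wpM2l // -mulr_suml.
by apply: ler_pM; rewrite ?geometric_half_le // sumr_ge0 // => i _; rewrite exprn_ge0 ?invr_ge0.
Qed.

Lemma convergent_geo f g : convergent f -> convergent g ->
  exists A B : R, [/\ 0 < A, 0 <= B & forall i j,
  cabs (f i j) <= B * A ^+ (i + j) /\ cabs (g i j) <= B * A ^+ (i + j)].
Proof.
move=> /convergentP [A1 [B1 [A10 B10 h1]]] /convergentP [A2 [B2 [A20 B20 h2]]].
exists (A1 + A2), (B1 + B2); split; [exact: addr_gt0|exact: addr_ge0|].
move=> i j; split; [apply: le_trans (h1 i j) _|apply: le_trans (h2 i j) _].
  apply: ler_pM; rewrite ?exprn_ge0 ?lerDl // ?(ltW A10) //.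
  by rewrite lerXn2r ?nnegrE ?addr_ge0 ?lerDl ?ltW.
apply: ler_pM; rewrite ?exprn_ge0 ?lerDr // ?(ltW A20) //.
by rewrite lerXn2r ?nnegrE ?addr_ge0 ?lerDr ?ltW.
Qed.

Lemma convergentD f g : convergent f -> convergent g -> convergent (ps_add f g).
Proof.
move=> cf cg; have [A [B [A0 B0 h]]] := convergent_geo cf cg.
apply/convergentP; exists A, (B + B); split=> // [|i j]; first exact: addr_ge0.
have [h1 h2] := h i j.
by rewrite /ps_add (le_trans (cabsD _ _)) // mulrDl lerD.
Qed.

Lemma succn_le_exp2 n : (n.+1%:R : R) <= 2 ^+ n.
Proof. by rewrite -natrX ler_nat ltn_expl. Qed.

(** The coefficient at [(i, j)] has [(i+1)(j+1)] terms of size at most [B^2 A^(i+j)]; doubling [A]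
    absorbs their number. *)
Lemma convergentM f g : convergent f -> convergent g -> convergent (ps_mul f g).
Proof.
move=> cf cg; have [A [B [A0 B0 h]]] := convergent_geo cf cg.
apply/convergentP; exists (2 * A), (B * B); split=> [||i j].
- by rewrite mulr_gt0.
- by rewrite mulr_ge0.
rewrite /ps_mul; apply: le_trans (cabs_sum _ _ _) _.
apply: (@le_trans _ _ (\sum_(k < i.+1) \sum_(l < j.+1) B * B * A ^+ (i + j))).
  apply: ler_sum => k _; apply: le_trans (cabs_sum _ _ _) _.
  apply: ler_sum => l _; rewrite cabsM.
  have [h1 _] := h k l; have [_ h2] := h (i - k)%N (j - l)%N.
  apply: le_trans (ler_pM (cabs_ge0 _) (cabs_ge0 _) h1 h2) _.
  by rewrite mulrACA -exprD addnACA !subnKC // leq_ord.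
under eq_bigr do rewrite sumr_const card_ord.
rewrite sumr_const card_ord -mulrnA -[leLHS]mulr_natr -[leLHS]mulrA.
rewrite ler_wpM2l ?mulr_ge0 //.
rewrite exprMn mulrC ler_wpM2r ?exprn_ge0 ?(ltW A0) //.
by rewrite natrM exprD mulrC ler_pM ?ler0n // succn_le_exp2.
Qed.

Lemma convergent_poly p : convergent (ps_of_poly p).
Proof.
apply/convergentP.
pose B := \sum_(j < size p) \sum_(i < size p`_j) cabs (pcoef p i j).
exists 1, B; split=> // [|i j].
  by rewrite sumr_ge0 // => j _; rewrite sumr_ge0 // => i _; rewrite cabs_ge0.
rewrite expr1n mulr1 /ps_of_poly.
have B0 : 0 <= B.
  by rewrite sumr_ge0 // => l _; rewrite sumr_ge0 // => k _; rewrite cabs_ge0.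
case: (ltnP j (size p)) => hj; last first.
  by rewrite /pcoef (nth_default _ hj) coef0 cabs0.
case: (ltnP i (size p`_j)) => hi; last first.
  by rewrite /pcoef (nth_default _ hi) cabs0.
rewrite /B (bigD1 (Ordinal hj)) //= (bigD1 (Ordinal hi)) //= -addrA lerDl.
rewrite addr_ge0 ?sumr_ge0 // => k _; rewrite ?cabs_ge0 //.
by rewrite sumr_ge0 // => l _; rewrite cabs_ge0.
Qed.

Lemma convergent_zero : convergent (fun _ _ => 0 : C).
Proof.
by apply/convergentP; exists 1, 0; split=> // i j; rewrite cabs0 mul0r.
Qed.

Lemma ps_mul0 f : ps_mul (fun _ _ => 0) f = fun _ _ => 0.
Proof.
apply/funext => i; apply/funext => j; rewrite /ps_mul big1 // => k _.
by rewrite big1 // => l _; rewrite mul0r.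
Qed.

Lemma ps_mul1 p : ps_mul (ps_of_poly 1) (ps_of_poly p) = ps_of_poly p.
Proof. by rewrite -ps_of_polyM mul1r. Qed.

Lemma convergent_shift f N k : convergent f ->
  convergent (fun i j => f (i + N)%N (j + k)%N).
Proof.
move=> /convergentP [A [B [A0 B0 h]]]; apply/convergentP.
exists A, (B * A ^+ (N + k)); split=> // [|i j].
  by rewrite mulr_ge0 // exprn_ge0 // ltW.
by rewrite -mulrA -exprD; apply: le_trans (h _ _) _; rewrite addnACA addnC.
Qed.

Lemma trunc_decomp N f : convergent f -> exists c d,
  [/\ convergent c, convergent d &
   f = ps_add (ps_of_poly (trunc N f))
     (ps_add (ps_mul (ps_of_poly ('X^N)%:P) c) (ps_mul (ps_of_poly 'X^N) d))].
Proof.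
move=> cf; exists (fun i j => f (i + N)%N (j + 0)%N).
(* The series multiplied by [y^N] keeps only the terms with [i < N], since [x^N] already accounts
   for the others. *)
exists (fun i j => if (i < N)%N then f (i + 0)%N (j + N)%N else 0); split.
- exact: convergent_shift.
- have /convergentP [A [B [A0 B0 h]]] := convergent_shift 0 N cf.
  apply/convergentP; exists A, B; split=> // i j; case: ifP => // _.
  by rewrite cabs0 mulr_ge0 // exprn_ge0 // ltW.
apply/funext => i; apply/funext => j.
rewrite /ps_add ps_mul_xN ps_mul_yN /ps_of_poly pcoef_trunc !addn0.
case: (ltnP i N) => hi; case: (ltnP j N) => hj /=; rewrite ?add0r ?addr0 //.
- by rewrite subnK.
- by rewrite subnK.
- by rewrite subnK.
Qed.

(** Every monomial outside the box is a multiple of [x^N] or of [y^N], and both powers lie in the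
    product. *)
Lemma Jpoly_box0 (s : seq ({poly C} * nat)) p :
  (forall u, u \in s -> u.1.[0] = 0) ->
  (forall i j, (i < \sum_(u <- s) u.2)%N -> (j < \sum_(u <- s) u.2)%N ->
    pcoef p i j = 0) -> Jpoly s p.
Proof.
set N := (\sum_(u <- s) u.2)%N => hs hp.
rewrite -(poly_take_drop N p); apply: JpolyD; last exact/JpolyM/Jpoly_yN.
have -> : take_poly N p = (\poly_(j < N) drop_poly N p`_j) * ('X^N)%:P.
  apply/polyP => j; rewrite coefMC coef_take_poly coef_poly.
  case: ifP => hj; last by rewrite mul0r.
  rewrite -{1}(poly_take_drop N p`_j); suff -> : take_poly N p`_j = 0 by rewrite add0r.
  by apply/polyP => i; rewrite coef_take_poly coef0; case: ifP => // hi; apply: hp.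
exact/JpolyM/Jpoly_xN.
Qed.

(** * The product ideal in [C{x,y}] and its polynomial counterpart *)

Definition citem (u : {poly R} * nat) : {poly C} * nat :=
  (map_poly (real_complex R) u.1, (2 * u.2)%N).

Definition Jideal (s : seq ({poly R} * nat)) : ps R -> Prop :=
  ideal_prod [seq ideal2 (gen_y u.1) (gen_x R u.2) | u <- s].

Lemma gen_yE u : gen_y u.1 = ps_of_poly (ybr (citem u)).
Proof. by []. Qed.

Lemma gen_xE u : gen_x R u.2 = ps_of_poly (xbr (citem u)).
Proof. by []. Qed.

(** The three summands match the output of [trunc_decomp]: the truncation, a multiple of [x^N] and a
    multiple of [y^N]. The series factors stay fixed through the induction while the polynomials are
    split. *)
Lemma Jideal_of_Jpoly s p1 p2 p3 c1 c2 c3 :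
  Jpoly (map citem s) p1 -> Jpoly (map citem s) p2 -> Jpoly (map citem s) p3 ->
  convergent c1 -> convergent c2 -> convergent c3 ->
  Jideal s (ps_add (ps_mul (ps_of_poly p1) c1)
    (ps_add (ps_mul (ps_of_poly p2) c2) (ps_mul (ps_of_poly p3) c3))).
Proof.
elim: s p1 p2 p3 => [|u s IH] p1 p2 p3.
  move=> _ _ _ h1 h2 h3; rewrite /Jideal /=.
  by do ?apply: convergentD; apply: convergentM => //; apply: convergent_poly.
move=> /= [A1 [B1 [hA1 hB1 ->]]] [A2 [B2 [hA2 hB2 ->]]] [A3 [B3 [hA3 hB3 ->]]].
move=> h1 h2 h3.
rewrite /Jideal /= gen_yE gen_xE -/(Jideal s).
have hA := IH A1 A2 A3 hA1 hA2 hA3 h1 h2 h3.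
have hB := IH B1 B2 B3 hB1 hB2 hB3 h1 h2 h3.
move: (ybr (citem u)) (xbr (citem u)) => Y X.
exists 2%N, (fun k => if k is 0 then ps_of_poly Y else ps_of_poly X).
exists (fun k => if k is 0 then
   ps_add (ps_mul (ps_of_poly A1) c1)
    (ps_add (ps_mul (ps_of_poly A2) c2) (ps_mul (ps_of_poly A3) c3))
  else ps_add (ps_mul (ps_of_poly B1) c1)
    (ps_add (ps_mul (ps_of_poly B2) c2) (ps_mul (ps_of_poly B3) c3))).
split.
  case=> [|[|//]] _; (split; last by []).
  - exists (ps_of_poly 1), (fun _ _ => 0).
    split; first exact: convergent_poly.
    split; first exact: convergent_zero.
    by rewrite ps_mul0 ps_mul1 => i j; rewrite /ps_add addr0.
  - exists (fun _ _ => 0), (ps_of_poly 1).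
    split; first exact: convergent_zero.
    split; first exact: convergent_poly.
    by rewrite ps_mul0 ps_mul1 => i j; rewrite /ps_add add0r.
move=> i j; rewrite !big_ord_recl big_ord0 /= addr0.
rewrite !(ps_of_polyD, ps_of_polyM, ps_mulDl, ps_mulDr) !ps_mulA /ps_add.
ring.
Qed.

(** Truncating the cofactors in the generators of each ideal changes the series only modulo
    [(x^N, y^N)]. *)
Lemma Jpoly_of_Jideal s N f : Jideal s f ->
  exists2 p, Jpoly (map citem s) p & agree N f (ps_of_poly p).
Proof.
elim: s f => [|u s IH] f.
  by move=> _; exists (trunc N f) => //; apply: agree_trunc.
rewrite /Jideal /= gen_yE gen_xE -/(Jideal s).
move=> [n [a [b [hab hf]]]].
have H (k : 'I_n) : exists p, Jpoly (map citem (u :: s)) p /\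
    agree N (ps_mul (a k) (b k)) (ps_of_poly p).
  have [[c [d [_ [_ hcd]]]] /IH [p hp hbp]] := hab k (ltn_ord k).
  exists ((trunc N c * ybr (citem u) + trunc N d * xbr (citem u)) * p); split.
    rewrite mulrDl -!mulrA !(mulrCA (trunc N _)).
    by apply: JpolyD; [apply: Jpoly_ybr|apply: Jpoly_xbr]; apply: JpolyM.
  move: hcd; move: (ybr (citem u)) (xbr (citem u)) => Y X hcd.
  rewrite ps_of_polyM; apply: agree_mul => // i j hi hj.
  rewrite hcd ps_of_polyD !ps_of_polyM.
  by apply: (@agree_add N) => //; apply: agree_mul => //; apply: agree_trunc.
have {}[P hP] := choice H.
exists (\sum_k P k); first by apply: (@Jpoly_sum _ (map citem (u :: s))) => k; case: (hP k).
move=> i j hi hj; rewrite hf /ps_of_poly /pcoef !coef_sum.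
by apply: eq_bigr => k _; have [_ ->] := hP k.
Qed.

Definition total (s : seq ({poly R} * nat)) := (\sum_(u <- map citem s) u.2)%N.

Lemma JidealP s f : (forall u, u \in s -> u.1.[0] = 0) -> convergent f ->
  Jideal s f <-> Jpoly (map citem s) (trunc (total s) f).
Proof.
move=> hs cf; have {}hs u : u \in map citem s -> u.1.[0] = 0.
  by move=> /mapP [v vs ->] /=; rewrite -[0](rmorph0 (real_complex R)) horner_map hs.
split=> [/(Jpoly_of_Jideal (total s)) [p hp hfp]|h].
  rewrite -(subrK p (trunc _ f)); apply: JpolyD => //.
  apply: Jpoly_box0 => // i j hi hj.
  rewrite /pcoef !coefB -!/(pcoef _ _ _) pcoef_trunc hi hj hfp //.
  by rewrite /ps_of_poly subrr.
have [c [d [cc cd ->]]] := trunc_decomp (total s) cf.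
have one : convergent (ps_of_poly (1 : {poly {poly C}})) by exact: convergent_poly.
have := Jideal_of_Jpoly h (Jpoly_xN (map citem s)) (Jpoly_yN hs) one cc cd.
by rewrite -ps_of_polyM mulr1.
Qed.

End PowerSeries.

(** * Evaluation at real points and truncation errors *)

Section Evaluation.
Local Open Scope classical_set_scope.
Variable R : realType.
Local Notation C := R[i].
Implicit Types (p : {poly {poly C}}) (f : ps R) (x y t : R).

Lemma peval_horner p (v : {poly C}) (x : C) : (p.[v]).[x] = peval p x v.[x].
Proof.
rewrite /peval; elim/poly_ind: p => [|p c IH]; first by rewrite !horner0.
by rewrite !hornerMXaddC !(hornerD, hornerM) IH hornerC.
Qed.

Lemma pevalD p1 p2 (x y : C) : peval (p1 + p2) x y = peval p1 x y + peval p2 x y.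
Proof. by rewrite /peval !hornerD. Qed.

Lemma pevalM p1 p2 (x y : C) : peval (p1 * p2) x y = peval p1 x y * peval p2 x y.
Proof. by rewrite /peval !hornerM. Qed.

Lemma pevalC (c : {poly C}) (x y : C) : peval c%:P x y = c.[x].
Proof. by rewrite /peval hornerC. Qed.

Lemma pevalX (x y : C) : peval 'X x y = y.
Proof. by rewrite /peval hornerX hornerC. Qed.

Lemma horner_bound (c : {poly C}) :
  exists2 D : R, 0 <= D & forall x : C, cabs x <= 1 -> cabs c.[x] <= D.
Proof.
elim/poly_ind: c => [|c a [D D0 IH]].
  by exists 0 => // x _; rewrite horner0 cabs0.
exists (D + cabs a) => [|x hx]; first by rewrite addr_ge0 ?cabs_ge0.
rewrite hornerMXaddC; apply: le_trans (cabsD _ _) _; rewrite lerD2r cabsM.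
by rewrite -[leRHS]mulr1 ler_pM ?cabs_ge0 ?IH.
Qed.

Lemma peval_bound p : exists2 D : R, 0 <= D &
  forall x y : C, cabs x <= 1 -> cabs y <= 1 -> cabs (peval p x y) <= D.
Proof.
elim/poly_ind: p => [|p c [D D0 IH]].
  by exists 0 => // x y _ _; rewrite /peval !horner0 cabs0.
have [E E0 hE] := horner_bound c.
exists (D + E) => [|x y hx hy]; first exact: addr_ge0.
rewrite pevalD pevalM pevalX pevalC; apply: le_trans (cabsD _ _) _.
by rewrite lerD ?hE // cabsM -[leRHS]mulr1 ler_pM ?cabs_ge0 ?IH.
Qed.

Lemma ps_partialE f x y N :
  ps_partial f x y N = peval (trunc N f) (x%:C)%C (y%:C)%C.
Proof.
rewrite /ps_partial /peval /trunc horner_poly horner_sum exchange_big /=.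
apply: eq_bigr => j _; rewrite hornerM -polyC_exp hornerC horner_poly mulr_suml.
by apply: eq_bigr => i _.
Qed.

Lemma cabs_le_ReIm (z : C) : cabs z <= `|complex.Re z| + `|complex.Im z|.
Proof.
rewrite cabsE -[leRHS]ger0_norm ?addr_ge0 // -sqrtr_sqr ler_wsqrtr //.
rewrite -(real_normK (num_real (complex.Re z))) -(real_normK (num_real (complex.Im z))).
by rewrite sqrrD -addrA [X in _ <= _ + X]addrC addrA lerDl mulrn_wge0 ?mulr_ge0.
Qed.

(** A term outside the box has [i >= N] or [j >= N], so it gains [(|x|/r)^N] or [(|y|/r)^N] over the
    corresponding term of the majorant. *)
Lemma ps_partial_tail f (r B : R) x y N n : 0 < r ->
  (forall n, \sum_(i < n) \sum_(j < n) cabs (f i j) * r ^+ (i + j) <= B) ->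
  `|x| <= r -> `|y| <= r -> (N <= n)%N ->
  cabs (ps_partial f x y n - ps_partial f x y N) <=
    B * ((`|x| / r) ^+ N + (`|y| / r) ^+ N).
Proof.
move=> r0 hB hx hy leNn; pose T i j := f i j * (x%:C)%C ^+ i * (y%:C)%C ^+ j.
have -> : ps_partial f x y N =
    \sum_(i < n) \sum_(j < n) (if (i < N)%N && (j < N)%N then T i j else 0).
  rewrite /ps_partial (big_ord_widen n (fun i => \sum_(j < N) T i j) leNn).
  rewrite big_mkcond; apply: eq_bigr => i _; case: ifP => hi /=; last first.
    by rewrite big1.
  by rewrite (big_ord_widen n (fun j => T i j) leNn) big_mkcond.
rewrite /ps_partial -sumrB; under eq_bigr do rewrite -sumrB.
set D := (`|x| / r) ^+ N + (`|y| / r) ^+ N.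
have xr0 : 0 <= `|x| / r by rewrite divr_ge0 // ltW.
have yr0 : 0 <= `|y| / r by rewrite divr_ge0 // ltW.
have xr1 : `|x| / r <= 1 by rewrite ler_pdivrMr // mul1r.
have yr1 : `|y| / r <= 1 by rewrite ler_pdivrMr // mul1r.
have D0 : 0 <= D by rewrite addr_ge0 // exprn_ge0.
apply: le_trans (ler_wpM2r D0 (hB n)).
rewrite mulr_suml; apply: le_trans (cabs_sum _ _ _) _; apply: ler_sum => i _.
rewrite mulr_suml; apply: le_trans (cabs_sum _ _ _) _; apply: ler_sum => j _.
rewrite -/(T i j).
have pos : 0 <= cabs (f i j) * r ^+ (i + j).
  by rewrite mulr_ge0 ?cabs_ge0 // exprn_ge0 // ltW.
case: ifP => [_|hij]; first by rewrite subrr cabs0 mulr_ge0.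
have -> : cabs (T i j - 0) =
    cabs (f i j) * r ^+ (i + j) * ((`|x| / r) ^+ i * (`|y| / r) ^+ j).
  rewrite subr0 /T !cabsM !cabsX !cabs_real !expr_div_n exprD.
  by field; rewrite !expf_neq0 ?gt_eqF.
rewrite ler_wpM2l //; move/negbT: hij; rewrite negb_and -!leqNgt => /orP[h|h].
  rewrite -[leLHS]addr0 lerD ?exprn_ge0 // -[leRHS]mulr1.
  by rewrite ler_pM ?exprn_ge0 ?exprn_ile1 // ler_wiXn2l.
rewrite -[leLHS]add0r lerD ?exprn_ge0 // -[leRHS]mul1r.
by rewrite ler_pM ?exprn_ge0 ?exprn_ile1 // ler_wiXn2l.
Qed.

(** Adding [a n = -2D 2^-n], whose increments are [D 2^-n], makes the sequence nondecreasing and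
    keeps it bounded above, so monotone convergence applies. *)
Lemma is_cvgn_geometric (u : nat -> R) (D E : R) :
  (forall n, `|u n.+1 - u n| <= D * 2^-1 ^+ n) -> (forall n, `|u n| <= E) ->
  cvgn u.
Proof.
move=> hD hE; pose a n : R := - (2 * D) * 2^-1 ^+ n.
have D0 : 0 <= D by have := le_trans (normr_ge0 _) (hD 0%N); rewrite expr0 mulr1.
have aS n : a n.+1 - a n = D * 2^-1 ^+ n by rewrite /a exprS; field.
have a0 n : a n <= 0 by rewrite /a mulNr oppr_le0 mulr_ge0 ?exprn_ge0 ?invr_ge0 ?mulr_ge0.
have h0 n : 0 <= D * 2^-1 ^+ n by rewrite mulr_ge0 // exprn_ge0 // invr_ge0.
have ca : cvgn a.
  apply: nondecreasing_is_cvgn.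
    by apply/nondecreasing_seqP => n; rewrite -subr_ge0 aS.
  by exists 0 => _ [n _ <-].
have cua : cvgn (u \+ a).
  apply: nondecreasing_is_cvgn.
    apply/nondecreasing_seqP => n; rewrite -subr_ge0 /=.
    have -> : u n.+1 + a n.+1 - (u n + a n) = (u n.+1 - u n) + D * 2^-1 ^+ n.
      by rewrite -aS; ring.
    by have := hD n; rewrite ler_norml => /andP[h _]; rewrite -lerBlDr sub0r.
  exists E => _ [n _ <-] /=; rewrite -[leRHS]addr0 lerD //.
  exact: le_trans (ler_norm _) (hE n).
have -> : u = (u \+ a) \- a by apply/funext => n /=; rewrite addrK.
exact: is_cvgB.
Qed.

(** A [limn] is informative only for a convergent sequence, so convergence is delivered along with
    the order [N] estimate. *)
Lemma ps_eval_near f N : convergent f -> exists r D : R, [/\ 0 < r, 0 <= D &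
  forall x y, `|x| <= r -> `|y| <= r ->
  [/\ cvgn (fun n => complex.Re (ps_partial f x y n)),
      cvgn (fun n => complex.Im (ps_partial f x y n)) &
      cabs (ps_eval f x y - ps_partial f x y N) <= D * (`|x| ^+ N + `|y| ^+ N)]].
Proof.
move=> [r [r0 [B hB]]].
have B0 : 0 <= B by have := hB 0%N; rewrite big_ord0.
(* Halving the radius gives increments of ratio 1/2; the factor 2 comes from bounding real and
   imaginary parts separately. *)
exists (r / 2), (2 * B / r ^+ N); split; first by rewrite divr_gt0.
  by rewrite divr_ge0 ?mulr_ge0 // exprn_ge0 // ltW.
move=> x y hx hy.
have r2 : r / 2 <= r by rewrite ler_pdivrMr // mulr_natr mulr2n lerDl ltW.
have hx' := le_trans hx r2; have hy' := le_trans hy r2.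
have tail := ps_partial_tail r0 hB hx' hy'.
have half z : `|z| <= r / 2 -> `|z| / r <= 2^-1.
  by move=> hz; rewrite ler_pdivrMr // mulrC.
have step n : cabs (ps_partial f x y n.+1 - ps_partial f x y n) <= B * 2 * 2^-1 ^+ n.
  apply: le_trans (tail _ _ (leqnSn n)) _; rewrite -mulrA ler_wpM2l // mulr_natl mulr2n.
  by rewrite lerD // lerXn2r ?nnegrE ?divr_ge0 ?half ?invr_ge0 // ltW.
have bnd n : cabs (ps_partial f x y n) <= B * 2.
  have := tail 0%N n (leq0n n); rewrite !expr0 {2}/ps_partial big_ord0 subr0.
  by rewrite -[1 + 1]/(2%:R).
have subRe (z w : C) : complex.Re z - complex.Re w = complex.Re (z - w).
  by case: z w => ? ? [].
have subIm (z w : C) : complex.Im z - complex.Im w = complex.Im (z - w).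
  by case: z w => ? ? [].
have cR : cvgn (fun n => complex.Re (ps_partial f x y n)).
  apply: (@is_cvgn_geometric _ (B * 2) (B * 2)) => n; last first.
    exact: le_trans (cabs_Re _) (bnd n).
  by rewrite subRe; apply: le_trans (cabs_Re _) (step n).
have cI : cvgn (fun n => complex.Im (ps_partial f x y n)).
  apply: (@is_cvgn_geometric _ (B * 2) (B * 2)) => n; last first.
    exact: le_trans (cabs_Im _) (bnd n).
  by rewrite subIm; apply: le_trans (cabs_Im _) (step n).
split=> //; set E := B * ((`|x| / r) ^+ N + (`|y| / r) ^+ N).
have lim_le (u : nat -> R) c : cvgn u ->
    (forall n, (N <= n)%N -> `|u n - c| <= E) -> `|limn u - c| <= E.
  move=> cu hu; rewrite ler_distl; apply/andP; split.
    apply: limr_ge => //; near=> n; have := hu n.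
    by rewrite ler_distl => /(_ _)/andP[] //; near: n; exact: nbhs_infty_ge.
  apply: limr_le => //; near=> n; have := hu n.
  by rewrite ler_distl => /(_ _)/andP[] //; near: n; exact: nbhs_infty_ge.
have -> : 2 * B / r ^+ N * (`|x| ^+ N + `|y| ^+ N) = E + E.
  by rewrite /E !expr_div_n; field; rewrite expf_neq0 ?gt_eqF.
apply: le_trans (cabs_le_ReIm _) _; apply: lerD.
  rewrite -subRe /ps_eval /=; apply: lim_le => // n leNn.
  by rewrite subRe; apply: le_trans (cabs_Re _) (tail _ _ leNn).
rewrite -subIm /ps_eval /=; apply: lim_le => // n leNn.
by rewrite subIm; apply: le_trans (cabs_Im _) (tail _ _ leNn).
Unshelve. all: by end_near.
Qed.

End Evaluation.

(** * Size of [[P]] near the origin and along the curves *)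

Section BracketBounds.
Local Open Scope classical_set_scope.
Variable R : realType.
Local Notation C := R[i].
Implicit Types (u j : {poly R} * nat) (s : seq ({poly R} * nat))
  (p : {poly {poly C}}) (x y t : R).

Definition bfac u x y : C :=
  ((y%:C + (u.1.[x])%:C + 'i * (x%:C) ^+ (2 * u.2))%C).

Lemma bfacE u x y : bfac u x y = Complex (y + u.1.[x]) (x ^+ (2 * u.2)).
Proof.
rewrite /bfac -rmorphXn -rmorphD /=.
by apply/eqP; rewrite eq_complex /=; apply/andP; split; apply/eqP; ring.
Qed.

Lemma peval_ybr u x y :
  peval (ybr (citem u)) (x%:C)%C (y%:C)%C = ((y + u.1.[x])%:C)%C.
Proof.
by rewrite /ybr /citem pevalD pevalX pevalC /= horner_map -rmorphD.
Qed.

Lemma peval_xbr u x y :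
  peval (xbr (citem u)) (x%:C)%C (y%:C)%C = ((x ^+ (2 * u.2))%:C)%C.
Proof. by rewrite /xbr /citem pevalC /= hornerXn -rmorphXn. Qed.

Lemma Jpoly_bound s p : Jpoly (map (@citem R) s) p -> exists2 D : R, 0 <= D &
  forall x y, `|x| <= 1 -> `|y| <= 1 ->
  cabs (peval p (x%:C)%C (y%:C)%C) <= D * \prod_(u <- s) cabs (bfac u x y).
Proof.
elim: s p => [|u s IH] p /=.
  move=> _; have [D D0 hD] := peval_bound p; exists D => // x y hx hy.
  by rewrite big_nil mulr1 hD // cabs_real.
move=> [A [B [/IH [D1 D10 h1] /IH [D2 D20 h2] ->]]].
exists (D1 + D2) => [|x y hx hy]; first exact: addr_ge0.
rewrite big_cons pevalD !pevalM peval_ybr peval_xbr.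
apply: le_trans (cabsD _ _) _; rewrite !cabsM !cabs_real.
have le1 : `|y + u.1.[x]| <= cabs (bfac u x y).
  by apply: le_trans (cabs_Re _); rewrite bfacE.
have le2 : `|x ^+ (2 * u.2)| <= cabs (bfac u x y).
  by apply: le_trans (cabs_Im _); rewrite bfacE.
rewrite mulrDl; apply: lerD; rewrite mulrCA; apply: ler_pM; rewrite ?cabs_ge0 //.
  exact: h1.
exact: h2.
Qed.

Definition curve_y j x t : R := t * x ^+ (2 * j.2) - j.1.[x].

Lemma peval_pull j p x t : peval (pull (citem j) p) (x%:C)%C (t%:C)%C =
  peval p (x%:C)%C ((curve_y j x t)%:C)%C.
Proof.
rewrite {1}/peval /pull horner_comp peval_horner; congr (peval _ _ _).
rewrite /curve /citem /curve_y !(hornerD, hornerN, hornerM, hornerC, hornerX) /=.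
rewrite hornerXn horner_map rmorphB rmorphM rmorphXn /=.
by rewrite mulrC.
Qed.

(** On the curve the factor is [t x^a_j + (q_u - q_j) + i x^a_u]. The contact is at most each
    exponent and its power of [x] divides the difference; these three terms give the summands of
    [1 + D + 1]. *)
Lemma bfac_curve_bound u j : exists2 D : R, 0 <= D & forall x t,
  0 < x -> x <= 1 -> 0 <= t -> t <= 1 ->
  cabs (bfac u x (curve_y j x t)) <= D * x ^+ contact (citem u) (citem j).
Proof.
have [g [hg _]] := contact_factor (citem u) (citem j).
set c := contact _ _ in hg *; have [D D0 hD] := horner_bound g.
have cu : (c <= 2 * u.2)%N by apply: contact_lel.
have cj : (c <= 2 * j.2)%N by apply: contact_ler.
exists (1 + D + 1) => [|x t x0 x1 t0 t1]; first by rewrite !addr_ge0.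
have le_pow n : (c <= n)%N -> x ^+ n <= x ^+ c.
  by move=> h; apply: ler_wiXn2l => //; apply: ltW.
have pow0 n : 0 <= x ^+ n by rewrite exprn_ge0 // ltW.
have hd : `|u.1.[x] - j.1.[x]| <= D * x ^+ c.
  have := congr1 (fun z : {poly C} => z.[(x%:C)%C]) hg.
  rewrite hornerD hornerN /= !horner_map -rmorphB /= hornerM hornerXn -rmorphXn /=.
  move/(congr1 (@cabs R)); rewrite cabsM !cabs_real => ->.
  rewrite (ger0_norm (pow0 _)) mulrC ler_pM ?cabs_ge0 //.
  by apply: hD; rewrite cabs_real ger0_norm // ltW.
rewrite bfacE; apply: le_trans (cabs_le_ReIm _) _ => /=.
have -> : curve_y j x t + u.1.[x] = t * x ^+ (2 * j.2) + (u.1.[x] - j.1.[x]).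
  by rewrite /curve_y; ring.
rewrite !mulrDl !mul1r (ger0_norm (pow0 _)) lerD ?le_pow //.
apply: le_trans (ler_normD _ _) _; rewrite lerD // ger0_norm ?mulr_ge0 //.
by rewrite -[leRHS]mul1r ler_pM // le_pow.
Qed.

Lemma bracket_curve_bound s j : exists2 D : R, 0 <= D & forall x t,
  0 < x -> x <= 1 -> 0 <= t -> t <= 1 ->
  \prod_(u <- s) cabs (bfac u x (curve_y j x t)) <=
    D * x ^+ contact_sum (map (@citem R) s) (citem j).
Proof.
elim: s => [|u s [D D0 IH]].
  by exists 1 => // x t *; rewrite big_nil /contact_sum big_nil mulr1.
have [E E0 hE] := bfac_curve_bound u j.
exists (E * D) => [|x t x0 x1 t0 t1]; first exact: mulr_ge0.
rewrite big_cons /contact_sum big_cons exprD mulrACA.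
by rewrite ler_pM ?cabs_ge0 ?prodr_ge0 ?hE ?IH // => i _; rewrite cabs_ge0.
Qed.

End BracketBounds.

(** * Measurability and divergence of the integral *)

Section Measurability.
Local Open Scope classical_set_scope.
Variable R : realType.
Local Notation C := R[i].
Local Notation leb2R := ((@lebesgue_measure R) \x (@lebesgue_measure R))%E.
Implicit Types (E : set (R * R)) (F G : R * R -> C) (p : {poly {poly C}}).

Lemma cmeasurable_cst E (c : C) : cmeasurable E (fun=> c).
Proof. by split; apply: measurable_cst. Qed.

Lemma cmeasurableD E F G :
  cmeasurable E F -> cmeasurable E G -> cmeasurable E (fun z => F z + G z).
Proof.
move=> [F1 F2] [G1 G2]; split.
- have -> : (fun z => complex.Re (F z + G z)) =
    (fun z => complex.Re (F z)) \+ (fun z => complex.Re (G z)).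
    by apply/funext => z /=; case: (F z) (G z) => ? ? [].
  exact: measurable_funD.
- have -> : (fun z => complex.Im (F z + G z)) =
    (fun z => complex.Im (F z)) \+ (fun z => complex.Im (G z)).
    by apply/funext => z /=; case: (F z) (G z) => ? ? [].
  exact: measurable_funD.
Qed.

Lemma cmeasurableM E F G :
  cmeasurable E F -> cmeasurable E G -> cmeasurable E (fun z => F z * G z).
Proof.
move=> [F1 F2] [G1 G2]; split.
- have -> : (fun z => complex.Re (F z * G z)) =
    ((fun z => complex.Re (F z)) \* (fun z => complex.Re (G z))) \-
    ((fun z => complex.Im (F z)) \* (fun z => complex.Im (G z))).
    by apply/funext => z /=; case: (F z) (G z) => ? ? [].
  by apply: measurable_funB; apply: measurable_funM.
- have -> : (fun z => complex.Im (F z * G z)) =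
    ((fun z => complex.Re (F z)) \* (fun z => complex.Im (G z))) \+
    ((fun z => complex.Im (F z)) \* (fun z => complex.Re (G z))).
    by apply/funext => z /=; case: (F z) (G z) => ? ? [].
  by apply: measurable_funD; apply: measurable_funM.
Qed.

Lemma measurable_norm2 E F : cmeasurable E F ->
  measurable_fun E (fun z => complex.Re (F z) ^+ 2 + complex.Im (F z) ^+ 2).
Proof. by move=> [F1 F2]; apply: measurable_funD; apply: measurable_funX. Qed.

Lemma measurable_cabs E F : cmeasurable E F -> measurable_fun E (fun z => cabs (F z)).
Proof.
move=> /measurable_norm2 mF.
have -> : (fun z => cabs (F z)) = (fun x : R => x `^ 2^-1) \o
    (fun z => complex.Re (F z) ^+ 2 + complex.Im (F z) ^+ 2).
  by apply/funext => z /=; rewrite powR12_sqrt ?cabsE // addr_ge0 ?sqr_ge0.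
apply: measurableT_comp mF; exact: measurable_powR.
Qed.

Lemma cmeasurableV E F : cmeasurable E F -> cmeasurable E (fun z => (F z)^-1).
Proof.
move=> mF; have [F1 F2] := mF.
have mI : measurable_fun E
    (fun z => (complex.Re (F z) ^+ 2 + complex.Im (F z) ^+ 2)^-1).
  (* On nonnegative reals the power with exponent -1 is the inverse, including at 0, where both are
     0. *)
  have -> : (fun z => (complex.Re (F z) ^+ 2 + complex.Im (F z) ^+ 2)^-1) =
      (fun x : R => x `^ (-1)) \o
      (fun z => complex.Re (F z) ^+ 2 + complex.Im (F z) ^+ 2).
    by apply/funext => z /=; rewrite powR_inv1 // addr_ge0 ?sqr_ge0.
  apply: measurableT_comp (measurable_norm2 mF); exact: measurable_powR.
split.
- have -> : (fun z => complex.Re (F z)^-1) = (fun z => complex.Re (F z)) \*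
    (fun z => (complex.Re (F z) ^+ 2 + complex.Im (F z) ^+ 2)^-1).
    by apply/funext => z /=; case: (F z).
  exact: measurable_funM.
- have -> : (fun z => complex.Im (F z)^-1) = \- ((fun z => complex.Im (F z)) \*
    (fun z => (complex.Re (F z) ^+ 2 + complex.Im (F z) ^+ 2)^-1)).
    by apply/funext => z /=; case: (F z) => a b /=; rewrite ?mulNr.
  by apply: measurable_funN; apply: measurable_funM.
Qed.

Lemma cmeasurable_fst E : cmeasurable E (fun z => (z.1%:C)%C).
Proof.
split; last exact: measurable_cst.
by apply: measurable_funTS; apply: measurable_fst.
Qed.

Lemma cmeasurable_snd E : cmeasurable E (fun z => (z.2%:C)%C).
Proof.
split; last exact: measurable_cst.
by apply: measurable_funTS; apply: measurable_snd.
Qed.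

Lemma cmeasurable_peval E p : cmeasurable E (fun z => peval p (z.1%:C)%C (z.2%:C)%C).
Proof.
elim/poly_ind: p => [|p c IH].
  by under eq_fun do rewrite /peval !horner0; apply: cmeasurable_cst.
under eq_fun do rewrite pevalD pevalM pevalX pevalC.
apply: cmeasurableD; first exact: cmeasurableM IH (cmeasurable_snd E).
elim/poly_ind: c => [|c a IHc].
  by under eq_fun do rewrite horner0; apply: cmeasurable_cst.
under eq_fun do rewrite hornerMXaddC.
apply: cmeasurableD; last exact: cmeasurable_cst.
exact: cmeasurableM IHc (cmeasurable_fst E).
Qed.

Lemma cmeasurable_ps_eval E (f : ps R) :
  (forall z, E z -> cvgn (fun n => complex.Re (ps_partial f z.1 z.2 n)) /\
    cvgn (fun n => complex.Im (ps_partial f z.1 z.2 n))) ->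
  cmeasurable E (fun z => ps_eval f z.1 z.2).
Proof.
have mP n : cmeasurable E (fun z => ps_partial f z.1 z.2 n).
  by under eq_fun do rewrite ps_partialE; apply: cmeasurable_peval.
move=> h; split.
- apply: (@measurable_fun_cvg _ _ _ _
    (fun n z => complex.Re (ps_partial f z.1 z.2 n))) => [n|z /h []] //.
  by case: (mP n).
- apply: (@measurable_fun_cvg _ _ _ _
    (fun n z => complex.Im (ps_partial f z.1 z.2 n))) => [n|z /h []] //.
  by case: (mP n).
Qed.

Lemma measurable_horner_fst E (q : {poly R}) : measurable_fun E (fun z : R * R => q.[z.1]).
Proof.
elim/poly_ind: q => [|q a IH].
  by under eq_fun do rewrite horner0; apply: measurable_cst.
under eq_fun do rewrite hornerMXaddC.
apply: measurable_funD; last exact: measurable_cst.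
by apply: measurable_funM IH _; apply: measurable_funTS; apply: measurable_fst.
Qed.

Lemma sqrE (e : R) : sqr e = `]-e, e[ `*` `]-e, e[.
Proof.
apply/seteqP; split=> [z [h1 h2]|z [h1 h2]]; split => /=.
- by rewrite in_itv /= -ltr_norml.
- by rewrite in_itv /= -ltr_norml.
- by move: h1; rewrite /= in_itv /= -ltr_norml.
- by move: h2; rewrite /= in_itv /= -ltr_norml.
Qed.

Lemma measurable_sqr (e : R) : measurable (sqr e).
Proof. by rewrite sqrE; apply: measurableX; apply: measurable_itv. Qed.

Lemma leb2_sqr (e : R) : (leb2R (sqr e) < +oo)%E.
Proof.
rewrite sqrE product_measure1E; [|exact: measurable_itv|exact: measurable_itv].
rewrite /= lebesgue_measure_itv /=; case: ifP => _; last by rewrite mul0e ltry.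
by rewrite -EFinB -EFinM ltry.
Qed.

Lemma Linf_Lp (p : nat) F : Linf_loc F -> Lp_loc p F.
Proof.
move=> [e [e0 [mF [B hB]]]]; exists e; split=> //; split=> //.
rewrite /leb2 in hB *.
have mFp : measurable_fun (sqr e) (fun z => (cabs (F z) ^+ p)%:E).
  by apply/measurable_EFinP; apply: measurable_funX; apply: measurable_cabs.
(* The square has finite measure; [|B|] is used because the sign of [B] is not given. *)
have := @integral_le_bound _ _ _ (leb2R) (sqr e) (fun z => (cabs (F z) ^+ p)%:E)
  ((`|B| ^+ p)%:E) (measurable_sqr e) mFp.
under eq_integral do rewrite gee0_abs ?lee_fin ?exprn_ge0 ?cabs_ge0 //.
move=> H; apply: le_lt_trans (H _ _) _.
- by rewrite lee_fin exprn_ge0.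
- case: hB => A [mA A0 sA]; exists A; split=> // z hz; apply: sA => hz'.
  apply: hz => /hz' {}hz; rewrite lee_fin ger0_norm ?exprn_ge0 ?cabs_ge0 //.
  by rewrite lerXn2r ?nnegrE ?cabs_ge0 // (le_trans hz) // ler_norm.
by rewrite lte_mul_pinfty ?lee_fin ?exprn_ge0 // leb2_sqr.
Qed.

End Measurability.

(** * Divergence of the integral over a region between two curves *)

Section Divergence.
Local Open Scope classical_set_scope.
Variable R : realType.
Local Notation leb2R := ((@lebesgue_measure R) \x (@lebesgue_measure R))%E.
Variables (g : R * R -> R) (e : R) (q : {poly R}) (a K : nat) (t1 t2 d c : R).
Hypothesis mg : measurable_fun (sqr e) g.
Hypothesis g0 : forall z, 0 <= g z.
Hypothesis aK : (a <= K)%N.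
Hypothesis t12 : t1 < t2.
Hypothesis d0 : 0 < d.
Hypothesis d1 : d <= 1.
Hypothesis c0 : 0 < c.
Hypothesis hg : forall x t, 0 < x -> x <= d -> t1 <= t -> t <= t2 ->
  sqr e (x, t * x ^+ a - q.[x]) /\ c / x <= g (x, t * x ^+ a - q.[x]).

(** Dyadic points: the intervals []xk k, 2 xk k]] are disjoint, and the part of the region above
    each contributes at least a fixed positive amount. *)
Let xk k : R := d * 2^-1 ^+ k.+1.

Let xk_gt0 k : 0 < xk k.
Proof. by rewrite /xk mulr_gt0 // exprn_gt0 // invr_gt0. Qed.

Let xkS k : xk k * 2 = d * 2^-1 ^+ k.
Proof. by rewrite /xk exprS; field. Qed.

Let xk_le k : xk k * 2 <= d.
Proof.
rewrite xkS -[leRHS]mulr1 ler_wpM2l ?(ltW d0) // exprn_ile1 ?invr_ge0 //.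
by rewrite invf_le1 // ler1n.
Qed.

Let strip k : set (R * R) := [set z | xk k < z.1 <= xk k * 2] `&`
  ([set z | 0 <= z.2 + q.[z.1] - t1 * z.1 ^+ a] `&`
   [set z | 0 <= t2 * z.1 ^+ a - (z.2 + q.[z.1])]).

Let measurable_ge0 (h : R * R -> R) : measurable_fun setT h ->
  measurable [set z | 0 <= h z].
Proof.
move=> mh; have -> : [set z | 0 <= h z] = setT `&` h @^-1` `[0, +oo[.
  by apply/seteqP; split=> z /=; rewrite in_itv /= andbT; [split|case].
by apply: mh => //; apply: measurable_itv.
Qed.

Let mstrip k : measurable (strip k).
Proof.
have m1 : measurable_fun setT (fun z : R * R => z.1) by exact: measurable_fst.
have m2 : measurable_fun setT (fun z : R * R => z.2) by exact: measurable_snd.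
have mq := @measurable_horner_fst R setT q.
apply: measurableI.
  have -> : [set z : R * R | xk k < z.1 <= xk k * 2] =
      setT `&` fst @^-1` `]xk k, xk k * 2].
    by apply/seteqP; split=> z /=; rewrite in_itv /=; [split|case].
  by apply: m1 => //; apply: measurable_itv.
have mt (t : R) : measurable_fun setT (fun z : R * R => t * z.1 ^+ a).
  by apply: measurable_funM; [exact: measurable_cst|exact: measurable_funX].
have my : measurable_fun setT (fun z : R * R => z.2 + q.[z.1]).
  exact: measurable_funD.
by apply: measurableI; apply: measurable_ge0; apply: measurable_funB.
Qed.

Let stripP k z : strip k z -> sqr e z /\ c / (xk k * 2) <= g z.
Proof.
case: z => x y [/= /andP[hx1 hx2] [h1 h2]].
have x0 : 0 < x by apply: lt_trans hx1.
have xa : 0 < x ^+ a by rewrite exprn_gt0.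
pose t := (y + q.[x]) / x ^+ a.
have yE : y = t * x ^+ a - q.[x] by rewrite /t divfK ?gt_eqF // addrK.
have [|||hs hc] := @hg x t x0.
- exact: le_trans hx2 (xk_le k).
- by rewrite /t ler_pdivlMr // -subr_ge0.
- by rewrite /t ler_pdivrMr // -subr_ge0.
rewrite -yE in hs hc; split=> //; apply: le_trans hc.
by rewrite ler_wpM2l ?(ltW c0) // lef_pV2 // posrE // mulr_gt0.
Qed.

(** Integration of slices: the slice at [x] has length [(t2 - t1) x^a], at least its value at
    [xk k], over an interval of length [xk k]. *)
Let leb2_strip k : (((t2 - t1) * xk k ^+ a.+1)%:E <= leb2R (strip k))%E.
Proof.
rewrite /product_measure1.
have mitv : measurable (`]xk k, xk k * 2] : set R) by exact: measurable_itv.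
have msec := @measurable_fun_xsection _ _ _ _ _ (@lebesgue_measure R) _ (mstrip k).
refine (le_trans (y := (\int[@lebesgue_measure R]_(x in `]xk k, (xk k * 2)%R])
    (@lebesgue_measure R \o xsection (strip k)) x)%E) _ _); last first.
  by apply: ge0_subset_integral => //; move=> x _; apply: measure_ge0.
refine (le_trans (y := (\int[@lebesgue_measure R]_(x in `]xk k, (xk k * 2)%R])
    (cst ((t2 - t1) * xk k ^+ a)%:E) x)%E) _ _).
  rewrite integral_cst // /= lebesgue_measure_itv /= lte_fin.
  rewrite ifT; last by rewrite -subr_gt0 mulr_natr mulr2n addrK.
  by rewrite -EFinB -EFinM lee_fin mulr_natr mulr2n addrK exprSr mulrA.
apply: ge0_le_integral => //.
- move=> x _; rewrite lee_fin mulr_ge0 ?subr_ge0 ?(ltW t12) //.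
  by rewrite exprn_ge0 // ltW.
- exact: measurable_funTS.
move=> x /=; rewrite in_itv /= => /andP[hx1 hx2].
have x0 : 0 < x by apply: lt_trans hx1.
have -> : xsection (strip k) x = `[t1 * x ^+ a - q.[x], t2 * x ^+ a - q.[x]].
  apply/seteqP; split=> y.
    rewrite /xsection /= inE => -[_ /= [h1 h2]].
    by rewrite in_itv /= lerBlDr lerBrDr -(subr_ge0 (t1 * _)) h1 -subr_ge0 h2.
  rewrite /= in_itv /= lerBlDr lerBrDr -(subr_ge0 (t1 * _)) -(subr_ge0 (y + _)).
  by move=> /andP[h1 h2]; rewrite /xsection /= inE; split=> /=; rewrite ?hx1.
rewrite lebesgue_measure_itv /= lte_fin ltrD2r ltr_pM2r ?exprn_gt0 // t12.
rewrite -EFinB lee_fin.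
have -> : t2 * x ^+ a - q.[x] - (t1 * x ^+ a - q.[x]) = (t2 - t1) * x ^+ a by ring.
by rewrite ler_wpM2l ?subr_ge0 ?(ltW t12) // lerXn2r ?nnegrE ?ltW.
Qed.

Let int_strip k : (((c / 2) ^+ K.+1 * (t2 - t1))%:E <=
  \int[leb2R]_(z in strip k) (g z ^+ K.+1)%:E)%E.
Proof.
have cx0 : 0 <= c / (xk k * 2) by rewrite divr_ge0 ?mulr_ge0 // ltW.
apply: (@le_trans _ _ (\int[leb2R]_(z in strip k)
    (cst ((c / (xk k * 2)) ^+ K.+1)%:E) z)%E).
  rewrite integral_cst //; last exact: mstrip.
  apply: le_trans (lee_wpmul2l _ (leb2_strip k)); last first.
    by rewrite lee_fin exprn_ge0.
  rewrite -EFinM lee_fin.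
  have -> : (c / (xk k * 2)) ^+ K.+1 * ((t2 - t1) * xk k ^+ a.+1) =
      (c / 2) ^+ K.+1 * (t2 - t1) * (xk k ^+ a.+1 / xk k ^+ K.+1).
    by rewrite !expr_div_n exprMn; field; rewrite !expf_neq0 ?gt_eqF.
  rewrite -[leLHS]mulr1 ler_wpM2l //.
    by rewrite mulr_ge0 ?subr_ge0 ?(ltW t12) // exprn_ge0 // divr_ge0 // ltW.
  rewrite ler_pdivlMr ?exprn_gt0 // mul1r ler_wiXn2l // ?(ltW (xk_gt0 k)) //.
  apply: le_trans d1; apply: le_trans (xk_le k).
  by rewrite mulr_natr mulr2n lerDl ltW.
apply: ge0_le_integral.
- exact: mstrip.
- by move=> z _; rewrite lee_fin exprn_ge0.
- exact: measurable_cst.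
- apply: (@measurable_funS _ _ _ _ (sqr e)); first exact: measurable_sqr.
    by move=> z /stripP [].
  by apply/measurable_EFinP; apply: measurable_funX.
- move=> z /stripP [_ hz]; rewrite lee_fin lerXn2r ?nnegrE //.
Qed.

Lemma integral_diverges : ~ (\int[leb2R]_(z in sqr e) (g z ^+ K.+1)%:E < +oo)%E.
Proof.
move=> fin; set I := (\int[leb2R]_(z in sqr e) (g z ^+ K.+1)%:E)%E in fin.
set c' := (c / 2) ^+ K.+1 * (t2 - t1).
have c'0 : 0 < c' by rewrite mulr_gt0 ?subr_gt0 // exprn_gt0 // divr_gt0.
have mgK : measurable_fun (sqr e) (fun z => (g z ^+ K.+1)%:E).
  by apply/measurable_EFinP; apply: measurable_funX.
have gK0 z : (0 <= (g z ^+ K.+1)%:E)%E by rewrite lee_fin exprn_ge0.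
(* The first [n] strips are disjoint and lie in the square, so the integral exceeds every multiple
   of [c']. *)
have H n : ((c' *+ n)%:E <= I)%E.
  have sub : \big[setU/set0]_(i <- iota 0 n) strip i `<=` sqr e.
    by apply: (big_ind (fun A => A `<=` sqr e)) => // [A B hA hB|i _] z;
      [case; [exact: hA|exact: hB]|move=> /stripP []].
  have mU : measurable (\big[setU/set0]_(i <- iota 0 n) strip i).
    by apply: bigsetU_measurable => i _; apply: mstrip.
  refine (le_trans _ (ge0_subset_integral leb2R mU (measurable_sqr e) mgK _ sub)) => //.
  rewrite ge0_integral_bigsetU //=; last 3 first.
  - exact: iota_uniq.
  - apply/trivIsetP => i j _ _.
    wlog lt_ij : i j / (i < j)%N.
      by move=> W; rewrite neq_ltn => /orP[h|h]; [|rewrite setIC]; apply: W => //;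
        rewrite neq_ltn h ?orbT.
    move=> _; apply/seteqP; split=> // z [[/= /andP[h1 _] _] [/andP[_ h2] _]].
    have : xk i < xk i; last by rewrite ltxx.
    apply: lt_le_trans h1 _; apply: le_trans h2 _; rewrite xkS /xk.
    rewrite ler_wpM2l ?(ltW d0) // ler_wiXn2l ?invr_ge0 //.
    by rewrite invf_le1 // ler1n.
  - exact: measurable_funS (measurable_sqr e) sub mgK.
  have -> : ((c' *+ n)%:E = \sum_(i <- iota 0 n) c'%:E)%E.
    by rewrite sumEFin big_const_seq count_predT size_iota iter_addr_0.
  by apply: lee_sum => i _; apply: int_strip.
have I0 : (0 <= I)%E by apply: integral_ge0 => z _.
have [r hr] : exists r : R, I = r%:E.
  by exists (fine I); rewrite fineK // ge0_fin_numE.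
have r0 : 0 <= r / c' by rewrite divr_ge0 ?(ltW c'0) // -lee_fin -hr.
have := archi_boundP r0; rewrite ltr_pdivrMr // mulr_natl.
by have := H (Num.bound (r / c')); rewrite hr lee_fin leNgt => /negP.
Qed.

End Divergence.

(** * Comparison of the ideals *)

Section LowerBounds.
Local Open Scope classical_set_scope.
Variable R : realType.
Local Notation C := R[i].

(** One of the points [1/(k+2)] in []0, 1[] is not a root, and the factorization
    [h - h(t0) = (X - t0) l] controls [h] near it. *)
Lemma poly_lower_bound (h : {poly C}) : h != 0 -> exists t1 t2 c : R,
  [/\ 0 <= t1, t1 < t2, t2 <= 1, 0 < c &
      forall t, t1 <= t -> t <= t2 -> c <= cabs h.[(t%:C)%C]].
Proof.
move=> h0; pose pt (k : nat) : R := (k.+2%:R)^-1.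
have [k hk] : exists k, ~~ root h ((pt k)%:C)%C.
  pose rs := [seq ((pt k)%:C)%C | k <- iota 0 (size h)].
  have : ~~ all (root h) rs.
    apply/negP => hall; have := max_poly_roots h0 hall.
    rewrite map_inj_uniq ?iota_uniq; last first.
      move=> i j [/invr_inj /eqP]; rewrite eqr_nat => /eqP; by case.
    by rewrite size_map size_iota ltnn => /(_ isT).
  by move=> /allPn [_ /mapP [k _ ->] hk]; exists k.
set t0 := pt k in hk.
have t00 : 0 < t0 by rewrite invr_gt0 ltr0n.
have t01 : t0 < 1 by rewrite invf_lt1 ?ltr0n // ltr1n.
set v := h.[(t0%:C)%C]; have v0 : 0 < cabs v by apply: cabs_gt0.
have /factor_theorem [l hl] : root (h - v%:P) (t0%:C)%C.
  by rewrite rootE hornerD hornerN hornerC subrr.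
have [D D0 hD] := horner_bound l.
(* The first bound keeps the interval inside [[0, 1]]; the second limits the variation of [h] to
   half of [|h(t0)|]. *)
pose ep := Num.min (1 - t0) (cabs v / (2 * (D + 1))).
have D1 : 0 < 2 * (D + 1) by rewrite mulr_gt0 // ltr_wpDl.
have ep0 : 0 < ep by rewrite lt_min subr_gt0 t01 divr_gt0.
have ep1 : ep <= 1 - t0 by rewrite ge_min lexx.
have epD : ep * D <= cabs v / 2.
  have : ep <= cabs v / (2 * (D + 1)) by rewrite ge_min lexx orbT.
  rewrite ler_pdivlMr // => H; rewrite ler_pdivlMr //; apply: le_trans H.
  by rewrite -mulrA ler_wpM2l ?(ltW ep0) // mulrC ler_wpM2l // lerDl.
exists t0, (t0 + ep), (cabs v / 2); split.
- exact: ltW.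
- by rewrite ltrDl.
- by rewrite addrC -lerBrDr.
- by rewrite divr_gt0.
move=> t ht1 ht2.
have hv : h.[(t%:C)%C] = v + l.[(t%:C)%C] * ((t - t0)%:C)%C.
  have -> : h = l * ('X - (t0%:C)%C%:P) + v%:P by rewrite -hl subrK.
  rewrite hornerD hornerM hornerXsubC !hornerC addrC rmorphB /=.
  by rewrite /v.
have tle : `|t| <= 1.
  rewrite ger0_norm; last by apply: le_trans ht1; apply: ltW.
  by apply: le_trans ht2 _; rewrite addrC -lerBrDr.
have hsmall : cabs (l.[(t%:C)%C] * ((t - t0)%:C)%C) <= cabs v / 2.
  apply: le_trans epD; rewrite cabsM cabs_real mulrC ler_pM ?cabs_ge0 //.
    by rewrite ger0_norm ?subr_ge0 // lerBlDl.
  by apply: hD; rewrite cabs_real.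
have := cabsD h.[(t%:C)%C] (- (l.[(t%:C)%C] * ((t - t0)%:C)%C)).
rewrite {1}hv addrK cabsN => H.
have := le_trans H (lerD (lexx _) hsmall); rewrite -lerBlDr.
by rewrite {1}[cabs v]splitr addrK.
Qed.

(** Writing [G = at0 G + x G2] with [G2] bounded, the second term costs at most half of the lower
    bound for [at0 G] once [x] is small. *)
Lemma at0_lower_bound (G : {poly {poly C}}) : at0 G != 0 ->
  exists t1 t2 c d : R, [/\ 0 <= t1, t1 < t2, t2 <= 1, 0 < c &
    0 < d /\ d <= 1 /\ forall x t, 0 < x -> x <= d -> t1 <= t -> t <= t2 ->
      c <= cabs (peval G (x%:C)%C (t%:C)%C)].
Proof.
move=> /poly_lower_bound [t1 [t2 [c [t10 t12 t21 c0 hc]]]].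
have [G2 hG2] : xdiv 1 (G - map_poly polyC (at0 G)).
  apply: at0_xdiv; rewrite /at0 rmorphB /= -map_poly_comp.
  rewrite [X in _ - X](_ : _ = map_poly (horner_eval 0) G) ?subrr //.
  by rewrite map_poly_id // => z _ /=; rewrite /horner_eval hornerC.
have [D D0 hD] := peval_bound G2.
have D1 : 0 < 2 * (D + 1) by rewrite mulr_gt0 // ltr_wpDl.
pose d := Num.min 1 (c / (2 * (D + 1))).
have d0 : 0 < d by rewrite lt_min ltr01 divr_gt0.
have d1 : d <= 1 by rewrite ge_min lexx.
exists t1, t2, (c / 2), d; split=> //; first by rewrite divr_gt0.
split=> //; split=> // x t x0 xd ht1 ht2.
have x1 : x <= 1 by apply: le_trans d1.
have t0 : 0 <= t by apply: le_trans ht1.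
have tt1 : t <= 1 by apply: le_trans t21.
have hE : peval G (x%:C)%C (t%:C)%C =
    (at0 G).[(t%:C)%C] + (x%:C)%C * peval G2 (x%:C)%C (t%:C)%C.
  rewrite -{1}(subrK (map_poly polyC (at0 G)) G) hG2 pevalD pevalM pevalC hornerXn expr1.
  by rewrite addrC {1}/peval horner_map hornerC.
have hsmall : cabs ((x%:C)%C * peval G2 (x%:C)%C (t%:C)%C) <= c / 2.
  rewrite cabsM cabs_real (ger0_norm (ltW x0)).
  apply: le_trans (_ : x * D <= _).
    by rewrite ler_wpM2l ?(ltW x0) // hD // cabs_real ger0_norm // ltW.
  have : x <= c / (2 * (D + 1)) by apply: le_trans xd _; rewrite ge_min lexx orbT.
  rewrite ler_pdivlMr // => H; rewrite ler_pdivlMr //; apply: le_trans H.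
  by rewrite -mulrA ler_wpM2l ?(ltW x0) // mulrC ler_wpM2l // lerDl.
have := cabsD (peval G (x%:C)%C (t%:C)%C) (- ((x%:C)%C * peval G2 (x%:C)%C (t%:C)%C)).
rewrite {1}hE addrK cabsN => H.
have := le_trans (le_trans (hc t ht1 ht2) H) (lerD (lexx _) hsmall).
by rewrite -lerBlDr {1}[c]splitr addrK.
Qed.

End LowerBounds.

(** * Boundedness and integrability of [Q/P] against the product ideal *)

Section Main.
Local Open Scope classical_set_scope.
Variable R : realType.
Local Notation C := R[i].
Variables (P : {poly {poly C}}) (s : seq ({poly R} * nat)) (e B : R).
Hypothesis s0 : forall u, u \in s -> u.1.[0] = 0.
Hypothesis sL : forall u, u \in s -> (0 < u.2)%N.
Hypothesis e0 : 0 < e.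
Hypothesis P0 : peval P 0 0 = 0.
Local Notation bracket x y := (\prod_(u <- s) bfac u x y).
Hypothesis hP : forall x y : R, (x, y) != (0, 0) -> `|x| < e -> `|y| < e ->
  [/\ peval P (x%:C)%C (y%:C)%C != 0,
      cabs (peval P (x%:C)%C (y%:C)%C / bracket x y) <= B &
      cabs (bracket x y / peval P (x%:C)%C (y%:C)%C) <= B].

Lemma cabs_prod (I : Type) (r : seq I) (F : I -> C) :
  cabs (\prod_(i <- r) F i) = \prod_(i <- r) cabs (F i).
Proof.
apply: (big_morph (@cabs R)); first exact: cabsM.
exact: Normc.normc1.
Qed.

(** The truncation of [Q] is bounded by [[P]]. So is the truncation error, of order [|x|^N + |y|^N],
    because [x^N] and [y^N] lie in the product ideal as well. *)
Lemma Jideal_Linf (Q : ps R) : convergent Q -> Jideal s Q ->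
  Linf_loc (fun z => ps_eval Q z.1 z.2 / peval P (z.1%:C)%C (z.2%:C)%C).
Proof.
move=> cQ /(JidealP s0 cQ) hQ.
have [D1 D10 h1] := Jpoly_bound hQ.
have s0' u : u \in map (@citem R) s -> u.1.[0] = 0.
  by move=> /mapP [v vs ->] /=; rewrite -[0](rmorph0 (real_complex R)) horner_map s0.
have [D2 D20 h2] := Jpoly_bound (Jpoly_xN (map (@citem R) s)).
have [D3 D30 h3] := Jpoly_bound (Jpoly_yN s0').
have [r [D [r0 D0 hr]]] := ps_eval_near (total s) cQ.
pose d := Num.min 1 (Num.min e r).
have d0 : 0 < d by rewrite !lt_min ltr01 e0 r0.
have d1 : d <= 1 by rewrite ge_min lexx.
have de : d <= e by rewrite !ge_min lexx orbT.
have dr : d <= r by rewrite !ge_min lexx !orbT.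
exists d; split=> //; split.
  apply: cmeasurableM; last exact/cmeasurableV/cmeasurable_peval.
  apply: cmeasurable_ps_eval => z [hx hy].
  by have [] := hr z.1 z.2 (ltW (lt_le_trans hx dr)) (ltW (lt_le_trans hy dr)).
exists ((D1 + D * (D2 + D3)) * B); apply: aeW => -[x y] [/= hx hy].
(* The sign of [B] is read off at the point [(d/2, 0)], where [B] bounds a modulus. *)
have B0 : 0 <= B.
  have [|||_ _ H] := hP (x := d / 2) (y := 0).
  - by rewrite xpair_eqE negb_and gt_eqF // divr_gt0.
  - rewrite ger0_norm ?divr_ge0 ?(ltW d0) //; apply: lt_le_trans de.
    by rewrite ltr_pdivrMr // mulr_natr mulr2n ltrDl.
  - by rewrite normr0.
  exact: le_trans (cabs_ge0 _) H.
have C0 : 0 <= D1 + D * (D2 + D3) by rewrite !addr_ge0 ?mulr_ge0 ?addr_ge0.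
(* At the origin [P] vanishes and the inverse of 0 is 0, so the quotient takes the value 0 there. *)
have [[-> ->]|neq] := eqVneq (x, y) (0, 0).
  by rewrite rmorph0 P0 invr0 mulr0 cabs0 mulr_ge0.
have hx1 := ltW (lt_le_trans hx d1); have hy1 := ltW (lt_le_trans hy d1).
have [Pn0 _ hB] := hP neq (lt_le_trans hx de) (lt_le_trans hy de).
have [_ _ hev] := hr x y (ltW (lt_le_trans hx dr)) (ltW (lt_le_trans hy dr)).
have evle : cabs (ps_eval Q x y) <= (D1 + D * (D2 + D3)) * cabs (bracket x y).
  rewrite -[ps_eval Q x y](subrK (ps_partial Q x y (total s))) addrC.
  apply: le_trans (cabsD _ _) _; rewrite cabs_prod mulrDl; apply: lerD.
    by rewrite ps_partialE; apply: h1.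
  apply: le_trans hev _; rewrite -mulrA ler_wpM2l // mulrDl; apply: lerD.
    by have := h2 x y hx1 hy1; rewrite pevalC hornerXn cabsX cabs_real.
  have := h3 x y hx1 hy1.
  by rewrite /peval hornerXn -polyC_exp hornerC cabsX cabs_real.
rewrite cabsM cabsV; apply: le_trans (ler_wpM2r _ evle) _.
  by rewrite invr_ge0 cabs_ge0.
by rewrite -mulrA ler_wpM2l // -cabsV -cabsM.
Qed.

(** The curves reach the origin at least linearly, since [q_j(0) = 0] and [2 L_j >= 1]. *)
Lemma curve_y_bound (j : {poly R} * nat) : j \in s -> exists2 E : R, 0 <= E &
  forall x t, 0 < x -> x <= 1 -> 0 <= t -> t <= 1 -> `|curve_y j x t| <= E * x.
Proof.
move=> js; have /factor_theorem [l hl] : root j.1 0 by apply/rootP/s0.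
have [D D0 hD] := horner_bound (map_poly (real_complex R) l).
exists (1 + D) => [|x t x0 x1 t0 t1]; first exact: addr_ge0.
have xx : `|x| = x by rewrite ger0_norm // ltW.
rewrite /curve_y; apply: le_trans (ler_normB _ _) _; rewrite mulrDl mul1r; apply: lerD.
  rewrite normrM normrX xx ger0_norm // -[leRHS]mul1r ler_pM ?exprn_ge0 ?(ltW x0) //.
  rewrite -[leRHS]expr1 ler_wiXn2l ?(ltW x0) //.
  by rewrite muln_gt0 /= sL.
rewrite hl hornerM hornerXsubC subr0 normrM xx ler_wpM2r ?(ltW x0) //.
have -> : `|l.[x]| = cabs (map_poly (real_complex R) l).[(x%:C)%C].
  by rewrite horner_map cabs_real.
by apply: hD; rewrite cabs_real xx.
Qed.

Lemma contact_sum_le_total j : (contact_sum (map (@citem R) s) j <= total s)%N.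
Proof. by apply: leq_sum => u _; apply: contact_lel. Qed.

(* If [x^n] exactly divides the pullback of the truncation of [Q] along the
   curves [y = t x^(2L_j) - q_j(x)], then [|Q / P| >= c / x] on a set
   [{0 < x <= d, t1 <= t <= t2}], which has enough area to make the
   [L^(K+1)] norm infinite. *)
Lemma Lp_xdiv (Q : ps R) K j n : convergent Q -> (2 * j.2 <= K)%N ->
  Lp_loc K.+1 (fun z => ps_eval Q z.1 z.2 / peval P (z.1%:C)%C (z.2%:C)%C) ->
  j \in s -> (n <= contact_sum (map (@citem R) s) (citem j))%N ->
  xdiv n (pull (citem j) (trunc (total s) Q)).
Proof.
move=> cQ jK [e' [e'0 [mQ intQ]]] js.
(* Divisibility is raised one power at a time: if the cofactor [G] of [x^n] is nonzero modulo [x],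
   its lower bound contradicts integrability. *)
elim: n => [|n IH] hn; first by exists (pull (citem j) (trunc (total s) Q)); rewrite mul1r.
have [G hG] := IH (ltnW hn).
have [/at0_xdiv [G' hG']|/at0_lower_bound] := eqVneq (at0 G) 0.
  by exists G'; rewrite hG hG' mulrA -polyCM -exprD addn1.
move=> [t1 [t2 [c [d [t10 t12 t21 c0 [d0 [d1 hc]]]]]]]; exfalso.
have [Db Db0 hDb] := bracket_curve_bound s j.
have [Ey Ey0 hEy] := curve_y_bound js.
have [r [D [r0 D0 hr]]] := ps_eval_near (total s) cQ.
(* On the curve [|y| <= Ey x], so this constant bounds the truncation error divided by [x^N]. *)
pose D' := D * (1 + Ey ^+ total s).
have D'0 : 0 <= D' by rewrite mulr_ge0 // addr_ge0 // exprn_ge0.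
pose m := Num.min (Num.min e e') r.
have m0 : 0 < m by rewrite !lt_min e0 e'0 r0.
have me : m <= e by rewrite !ge_min lexx.
have me' : m <= e' by rewrite !ge_min lexx !orbT.
have mr : m <= r by rewrite !ge_min lexx !orbT.
(* The three bounds respectively keep the lower bound on [G], force [x] and [|y|] below [m], and
   make the truncation error at most half of the main term [c x^n]. *)
pose dl := Num.min d (Num.min (m / (Ey + 2)) (c / (2 * (D' + 1)))).
have Ey2 : 0 < Ey + 2 by rewrite ltr_wpDl.
have D'1 : 0 < 2 * (D' + 1) by rewrite mulr_gt0 // ltr_wpDl.
have dl0 : 0 < dl by rewrite !lt_min d0 !divr_gt0.
have dl1 : dl <= 1 by apply: le_trans d1; rewrite ge_min lexx.
have dld : dl <= d by rewrite ge_min lexx.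
pose BD := (`|B| + 1) * (Db + 1).
have BD0 : 0 < BD by rewrite mulr_gt0 // ltr_wpDl.
(* The constant is the quotient of the bounds [|Q| >= (c/2) x^n] and [|P| <= BD x^(n+1)]. *)
apply: (@integral_diverges R _ e' j.1 (2 * j.2) K t1 t2 dl (c / 2 / BD)) intQ => //.
- exact: measurable_cabs.
- by move=> z; apply: cabs_ge0.
- by rewrite !divr_gt0.
move=> x t x0 xdl ht1 ht2; rewrite -/(curve_y j x t); set y := curve_y j x t.
have x1 := le_trans xdl dl1; have xd := le_trans xdl dld.
have t0 := le_trans t10 ht1; have tt1 := le_trans ht2 t21.
have xx : `|x| = x by rewrite ger0_norm // ltW.
have ym : `|y| <= Ey * x by apply: hEy.
have xm : x * (Ey + 2) <= m.
  rewrite -ler_pdivlMr //; apply: le_trans xdl _.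
  by rewrite !ge_min lexx !orbT.
have xltm : x < m.
  apply: lt_le_trans xm; rewrite -[ltLHS]mulr1 ltr_pM2l //.
  by rewrite ltr_wpDl // ltr1n.
have yltm : `|y| < m.
  apply: le_lt_trans ym _; apply: lt_le_trans xm.
  by rewrite mulrC ltr_pM2l // ltrDl.
split; first by split=> /=; rewrite ?xx; apply: lt_le_trans me'.
have xyn : (x, y) != (0, 0) by rewrite xpair_eqE negb_and gt_eqF.
have [||Pn0 hPB _] := hP xyn; [by rewrite xx (lt_le_trans xltm)|exact: lt_le_trans me|].
have hxr : `|x| <= r by rewrite xx (ltW (lt_le_trans xltm mr)).
have [_ _ hev] := hr x y hxr (ltW (lt_le_trans yltm mr)).
have {}hev : cabs (ps_eval Q x y - ps_partial Q x y (total s)) <= D' * x ^+ n.+1.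
  apply: le_trans hev _; rewrite /D' -mulrA ler_wpM2l // xx mulrDl mul1r.
  have hle : x ^+ total s <= x ^+ n.+1.
    rewrite ler_wiXn2l ?(ltW x0) //; apply: leq_trans hn _.
    exact: contact_sum_le_total.
  apply: lerD => //; apply: le_trans (_ : (Ey * x) ^+ total s <= _).
    by rewrite lerXn2r ?nnegrE ?mulr_ge0 ?(ltW x0).
  by rewrite exprMn ler_wpM2l ?exprn_ge0.
have lowT : c * x ^+ n <= cabs (ps_partial Q x y (total s)).
  rewrite ps_partialE -peval_pull hG pevalM pevalC hornerXn cabsM cabsX cabs_real xx.
  by rewrite mulrC ler_wpM2l ?exprn_ge0 ?(ltW x0) //; apply: hc.
have xD' : D' * x <= c / 2.
  have : x <= c / (2 * (D' + 1)) by apply: le_trans xdl _; rewrite !ge_min lexx !orbT.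
  rewrite ler_pdivlMr // => H; rewrite ler_pdivlMr //; apply: le_trans H.
  rewrite -subr_ge0; have -> : x * (2 * (D' + 1)) - D' * x * 2 = 2 * x by ring.
  by rewrite mulr_ge0 // ltW.
have lowQ : c / 2 * x ^+ n <= cabs (ps_eval Q x y).
  have H := cabsD (ps_eval Q x y) (- (ps_eval Q x y - ps_partial Q x y (total s))).
  rewrite cabsN opprB addrC subrK in H.
  have := le_trans (le_trans lowT H) (lerD (lexx _) hev).
  rewrite -lerBlDr; apply: le_trans.
  rewrite exprS mulrA -mulrBl ler_wpM2r ?exprn_ge0 ?(ltW x0) //.
  by rewrite {2}[c]splitr lerBrDr lerD2l.
have upP : cabs (peval P (x%:C)%C (y%:C)%C) <= BD * x ^+ n.+1.
  (* Every factor has imaginary part [x^(2L)], nonzero for [x > 0]. *)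
  have bn0 : bracket x y != 0.
    rewrite prodf_seq_neq0; apply/allP => u us /=; rewrite bfacE.
    by apply/eqP => -[_ /eqP]; rewrite expf_eq0 gt_eqF // andbF.
  have bpos : 0 < cabs (bracket x y) by apply: cabs_gt0.
  have B0 := le_trans (cabs_ge0 _) hPB.
  move: hPB; rewrite cabsM cabsV ler_pdivrMr // => /le_trans; apply.
  rewrite /BD -mulrA; apply: ler_pM.
  - exact: B0.
  - exact: cabs_ge0.
  - by apply: le_trans (ler_norm _) _; rewrite lerDl.
  rewrite cabs_prod; apply: le_trans (hDb x t x0 x1 t0 tt1) _.
  apply: ler_pM => //; [by rewrite exprn_ge0 // ltW|by rewrite lerDl|].
  by rewrite ler_wiXn2l // ltW.
have Ppos := cabs_gt0 Pn0.
rewrite cabsM cabsV ler_pdivlMr //; apply: le_trans lowQ.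
apply: le_trans (ler_wpM2l _ upP) _; first by rewrite !divr_ge0 // ltW.
by rewrite exprS le_eqVlt; apply/orP; left; apply/eqP; field; rewrite !gt_eqF.
Qed.

Lemma Lp_Jideal (Q : ps R) K : convergent Q ->
  (forall u, u \in s -> (2 * u.2 <= K)%N) ->
  Lp_loc K.+1 (fun z => ps_eval Q z.1 z.2 / peval P (z.1%:C)%C (z.2%:C)%C) ->
  Jideal s Q.
Proof.
move=> cQ hK hQ; apply/(JidealP s0 cQ)/Jpoly_of_pull => _ /mapP [u us ->].
by apply: (Lp_xdiv cQ (hK u us) hQ us).
Qed.

End Main.

Theorem theorem5p6 (R : realType) (P : {poly {poly R[i]}}) (M : nat)
    (L : nat -> nat) (q : nat -> {poly R}) :
  (forall z w : R[i], 0 < complex.Im z -> 0 < complex.Im w -> peval P z w != 0) ->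
  peval P 0 0 = 0 ->
  no_common_factor P (pconj P) ->
  bracket_data P M L q ->
  let K := (\max_(j < M) (2 * L j))%N in
  (forall Q, Ip P K.+1 Q -> Jprod M L q Q) /\
  (forall Q, convergent Q ->
     (Jprod M L q Q <-> Ip P K.+1 Q) /\ (Ip P K.+1 Q <-> Iinf P Q)).
Proof.
move=> _ P0 _ [_ [hq [e [B [e0 hP]]]]] K.
pose s := [seq (q j, L j) | j <- iota 0 M].
have sP u : u \in s -> exists2 j, (j < M)%N & u = (q j, L j).
  by move=> /mapP [j]; rewrite mem_iota /= => jM ->; exists j.
have s0 u : u \in s -> u.1.[0] = 0.
  by move=> /sP [j /hq [h _] ->].
(* If [L_j] were 0, the size bound would force [q_j = 0], against [q_j'(0) > 0]. *)
have sL u : u \in s -> (0 < u.2)%N.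
  move=> /sP [j /hq [_ [h1 h2]] ->] /=; rewrite lt0n; apply/eqP => L0.
  move: h2; rewrite L0 muln0 leqn0 size_poly_eq0 => /eqP qj0.
  by move: h1; rewrite qj0 deriv0 horner0 ltxx.
have sK u : u \in s -> (2 * u.2 <= K)%N.
  by move=> /sP [j jM ->]; apply: (leq_bigmax (Ordinal jM)).
have JE Q : Jprod M L q Q = Jideal s Q by rewrite /Jprod /Jideal -map_comp.
have bE x y : bracketP M L q x y = \prod_(u <- s) bfac u x y.
  rewrite /bracketP big_map; have -> : iota 0 M = index_iota 0 M.
    by rewrite /index_iota subn0.
  by rewrite big_mkord.
have hP' x y : (x, y) != (0, 0) -> `|x| < e -> `|y| < e ->
  [/\ peval P (x%:C)%C (y%:C)%C != 0,
      cabs (peval P (x%:C)%C (y%:C)%C / \prod_(u <- s) bfac u x y) <= B &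
      cabs ((\prod_(u <- s) bfac u x y) / peval P (x%:C)%C (y%:C)%C) <= B].
  by rewrite -bE; apply: hP.
(* The equalities follow from the cycle of inclusions formed by [IpJ], [JI] and [II]. *)
have IpJ Q : Ip P K.+1 Q -> Jprod M L q Q.
  by move=> [cQ hQ]; rewrite JE; apply: (Lp_Jideal s0 sL e0 hP' cQ sK hQ).
have JI Q : convergent Q -> Jprod M L q Q -> Iinf P Q.
  by move=> cQ; rewrite JE => hQ; split=> //; apply: (Jideal_Linf s0 e0 P0 hP').
have II Q : Iinf P Q -> Ip P K.+1 Q.
  by move=> [cQ hQ]; split=> //; apply: Linf_Lp.
split=> // Q cQ; split; split=> [h|h].
- exact/II/JI.
- exact: IpJ.
- exact/JI/IpJ.
- exact: II.
Qed.
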